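(* Let $d \geq 1$, and let $Y$ be a $\mathbb{Z}^d$ shift of finite type that contains a fixed point and has the finite extension property. Let $\mathcal{A}_X$ be a finite alphabet and let $\alpha_X \in [0,1]$. If $\log(\alpha_X |\mathcal{A}_X|) > h(Y)$, then there exists $\rho > 0$ such that for all large enough $n$, $$\mathbb{P}_{n,\alpha_X}\bigl(X \text{ factors onto } Y\bigr) \geq 1 - e^{-\rho n^d},$$ where $X = X(\mathcal{F}) \subset \mathcal{A}_X^{\mathbb{Z}^d}$ is the random $\mathbb{Z}^d$ SFT obtained from a random set $\mathcal{F}$ of forbidden patterns drawn according to $\mathbb{P}_{n,\alpha_X}$.
   Context: Patterns and subshifts. For a finite set (alphabet) $\mathcal{A}$, a pattern with shape $S \subset \mathbb{Z}^d$ is an element of $\mathcal{A}^S$; patterns are considered up to translation ($u\in\mathcal{A}^S$ and $v\in\mathcal{A}^{S+p}$ are identified if $u(s)=v(s+p)$ for all $s \in S$). The shift action on $\mathcal{A}^{\mathbb{Z}^d}$ (product topology) is $(\sigma_t x)(s) = x(s+t)$. A $\mathbb{Z}^d$ subshift is a closed shift-invariant subset of $\mathcal{A}^{\mathbb{Z}^d}$. For a set $\mathcal{F}$ of finite patterns, $X(\mathcal{F})$ is the set of $x \in \mathcal{A}^{\mathbb{Z}^d}$ containing no (translate of a) pattern from $\mathcal{F}$. A $\mathbb{Z}^d$ shift of finite type (SFT) is a subshift equal to $X(\mathcal{F})$ for some finite set $\mathcal{F}$ of finite patterns (one says $\mathcal{F}$ induces it). The language $\mathcal{L}(X)$ of a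 subshift $X$ is the set of all finite-shape patterns appearing in points of $X$, and $\mathcal{L}_S(X) = \mathcal{L}(X)\cap\mathcal{A}^S$ for finite $S$. A fixed point is a point $x$ with $\sigma_t x = x$ for all $t \in \mathbb{Z}^d$. Topological entropy: $h(X) = \lim_{n_1,\dots,n_d\to\infty} \frac{1}{\prod_{i=1}^d n_i}\log\bigl|\mathcal{L}_{\prod_{i=1}^d [1,n_i]}(X)\bigr|$ (intervals are in $\mathbb{Z}$). Factor map: a surjective continuous map $\phi : X\to Y$ between $\mathbb{Z}^d$ subshifts that commutes with the shift action; $X$ factors onto $Y$ if such a map exists. Finite extension property: for $g \in \mathbb{N}$, a $\mathbb{Z}^d$ SFT $X$ has the $g$-extension property if there exists a finite set $\mathcal{F}$ of forbidden finite patterns inducing $X$ such that: if a pattern $w$ with shape $S$ can be extended to a pattern on $S + [-g,g]^d$ that contains no pattern from $\mathcal{F}$, then $w \in \mathcal{L}(X)$, i.e. $w$ can be extended to a point on all of $\mathbb{Z}^d$ that contains no pattern from $\mathcal{F}$. $X$ has the finite extension property if it has the $g$-extension property for some $g \in \mathbb{N}$. Random SFTs: let $F_n = [0,n)^d \subset \mathbb{Z}^d$. For $\alpha \in [0,1]$ and $n \in \mathbb{N}$, $\mathbb{P}_{n,\alpha}$ is the probability measure on the power set of $\mathcal{A}^{F_n}$ given by $\mathbb{P}_{n,\alpha}(\{\mathcal{F}\}) = \alpha^{|\mathcal{A}|^{n^d} - |\mathcal{F}|}(1-\alpha)^{|\mathcal{F}|}$ for $\mathcal{F}\subset\mathcal{A}^{F_n}$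 (each pattern is independently forbidden with probability $1-\alpha$). The random $\mathbb{Z}^d$ SFT is $X(\mathcal{F}) = \{x \in \mathcal{A}^{\mathbb{Z}^d} : \forall p \in \mathbb{Z}^d,\ \sigma_p(x)|_{F_n}\notin\mathcal{F}\}$ with $\mathcal{F}$ drawn from $\mathbb{P}_{n,\alpha}$. *)

(* Defs.v *)
From HB Require Import structures.
From mathcomp Require Import all_boot all_order all_algebra finmap.
From mathcomp Require Import all_classical all_reals all_analysis.

Set Implicit Arguments.
Unset Strict Implicit.
Unset Printing Implicit Defensive.

Import Order.TTheory GRing.Theory Num.Theory.
Import numFieldNormedType.Exports.

Local Open Scope classical_set_scope.
Local Open Scope ring_scope.

Definition lattice (d : nat) := 'rV[int]_d.

Definition config (d : nat) (A : finType) : topologicalType :=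
  {ptws lattice d -> discrete_topology A}.

(* The shape of a finite pattern is the domain of the finite map. *)
Definition pattern (d : nat) (A : finType) := {fmap lattice d -> A}.

Definition pshape d (A : finType) (w : pattern d A) : set (lattice d) :=
  [set` domf w].

Definition shift_by d (A : finType) (t : lattice d) (x : config d A) :
  config d A := fun s => x (s + t).

Definition is_subshift d (A : finType) (X : set (config d A)) : Prop :=
  closed X /\ forall (t : lattice d) x, X x -> X (shift_by t x).

Definition fixed_point d (A : finType) (x : config d A) : Prop :=
  forall t : lattice d, shift_by t x = x.

(* Patterns are considered up to translation: w appears in x (resp. in v) when
   some translate of w agrees with x (resp. v) on all of its shape. *)
Definition appears d (A : finType) (w : pattern d A) (x : config d A) : Prop :=
  exists p : lattice d, forall s, s \in domf w -> w.[? s]%fmap = Some (x (s + p)).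

Definition subpattern d (A : finType) (w v : pattern d A) : Prop :=
  exists p : lattice d,
    forall s, s \in domf w -> w.[? s]%fmap = v.[? s + p]%fmap.

Definition avoid d (A : finType) (F : set (pattern d A)) : set (config d A) :=
  [set x | forall w, F w -> ~ appears w x].

Definition is_sft d (A : finType) (X : set (config d A)) : Prop :=
  is_subshift X /\
  exists F : set (pattern d A), finite_set F /\ X = avoid F.

Definition language d (A : finType) (X : set (config d A)) :
  set (pattern d A) := [set w | exists x, X x /\ appears w x].

(* Genuine elements of A^S: no quotient is needed here, since two patterns with
   the same finite shape S are translates of each other only if equal. *)
Definition language_on d (A : finType) (X : set (config d A))
  (S : set (lattice d)) : set (pattern d A) :=
  [set w | language X w /\ pshape w = S].

Definition box d (n : 'I_d -> nat) : set (lattice d) :=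
  [set s | forall i, 1 <= s ord0 i <= (n i)%:Z].

(* All of the n_i tend to infinity, independently of each other. *)
Definition all_to_oo d : set_system ('I_d -> nat) :=
  filter_from [set: nat] (fun N => [set n | forall i, (N <= n i)%N]).

(* Extended-real valued, with the logarithm lne such that lne 0 = -oo, so that
   the empty subshift has entropy -oo. *)
Definition entropy (R : realType) d (A : finType) (X : set (config d A)) :
  \bar R :=
  lim ((fun n : 'I_d -> nat =>
          ((\prod_(i < d) n i)%N%:R^-1)%:E *
          lne (#|` fset_set (language_on X (box n))|%:R%:E))%E
       @ @all_to_oo d).

Definition sym_cube d (g : nat) : set (lattice d) :=
  [set t | forall i, - g%:Z <= t ord0 i <= g%:Z].

Definition extends d (A : finType) (v w : pattern d A) : Prop :=
  forall s, s \in domf w -> v.[? s]%fmap = w.[? s]%fmap.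

Definition extension_property d (A : finType) (g : nat)
  (X : set (config d A)) : Prop :=
  exists F : set (pattern d A), [/\ finite_set F, X = avoid F &
    forall w : pattern d A,
      (exists v : pattern d A,
        [/\ pshape v = [set s + t | s in pshape w & t in sym_cube g],
            extends v w & forall u, F u -> ~ subpattern u v]) ->
      language X w].

Definition finite_extension_property d (A : finType)
  (X : set (config d A)) : Prop := exists g : nat, extension_property g X.

(* Only the restriction of phi to X matters. *)
Definition factors_onto d (A B : finType)
  (X : set (config d A)) (Y : set (config d B)) : Prop :=
  exists phi : config d A -> config d B,
    [/\ {within X, continuous phi}, phi @` X = Y &
        forall (t : lattice d) x, X x -> phi (shift_by t x) = shift_by t (phi x)].

(* The index set F_n = [0, n)^d and its inclusion in the lattice. *)
Definition cube (d n : nat) := {ffun 'I_d -> 'I_n}.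

Definition cube_pt d n (k : cube d n) : lattice d := \row_i (k i : nat)%:Z.

Definition cube_pattern (d n : nat) (A : finType) := {ffun cube d n -> A}.

Definition restrict_cube d (n : nat) (A : finType) (x : config d A) :
  cube_pattern d n A := [ffun k => x (cube_pt k)].

Definition random_sft d n (A : finType) (F : {set cube_pattern d n A}) :
  set (config d A) :=
  [set x | forall p : lattice d, restrict_cube n (shift_by p x) \notin F].

(* The probability of the event E, each pattern being independently forbidden
   with probability 1 - alpha: the sum over E of the point masses; here
   #|A| ^ (n ^ d) is the number of all patterns on F_n. *)
Definition forbid_prob (R : realType) d n (A : finType) (alpha : R)
  (E : set {set cube_pattern d n A}) : R :=
  \sum_(F : {set cube_pattern d n A} | F \in E)
    alpha ^+ (#|A| ^ (n ^ d) - #|F|) * (1 - alpha) ^+ #|F|.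

(* Main.v *)
Require Import Defs.
From HB Require Import structures.
From mathcomp Require Import all_boot all_order all_algebra finmap zify ring lra.
From mathcomp Require Import all_classical all_reals all_analysis.

Import Order.TTheory GRing.Theory Num.Theory.
Import numFieldNormedType.Exports.

Local Open Scope classical_set_scope.
Local Open Scope ring_scope.

(** The idea is that a random shift contains a set [W] of large square blocks
    that can be concatenated freely, can be recognised inside any configuration,
    and is large enough to name all the patterns of [Y] on a slightly larger
    square. Writing names of patterns next to each other then produces every
    point of [Y].

    The blocks have side [N], a large constant multiple of [n]. Take a block at
    random and wrap it on a torus. Its [N ^ d] windows of side [n] are typically
    distinct ([card_distinct]), and then they are all spared with probability
    [alpha ^ (N ^ d)], so that about [(alpha * #|AX|) ^ (N ^ d)] such blocks are
    expected. Two blocks are correlated only through common windows. A constant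
    number of recorded windows, one for each cell of a coarse grid, controls all
    the common ones, and it determines at least as many sites of the second block
    as there are common windows ([sum_shared_windows]). This bounds the relative
    variance by a polynomial times [(alpha * #|AX|) ^ (- n ^ d)], and Chebyshev's
    inequality gives the number of spared blocks up to an event of that
    probability ([second_moment], [prob_many_blocks]).

    Among the spared blocks, those with the most frequent collar of width [n]
    form [W]. A window in a concatenation of blocks of [W] is a window of one of
    these blocks, wrapped on the torus ([concat_blocksE]); so concatenation is
    free. The collar contains a full window, which by distinctness appears only
    once in each block. It serves as a marker, so that recognised blocks do not
    overlap ([detect_separated]). The collars cost a factor [exp (eps * N ^ d)]
    only, and [Y] has about [exp (h(Y) * N ^ d)] patterns; the inequality between
    the entropies makes [W] large enough. The defining limit of [h(Y)] has to be
    shown to exist for this ([entropy_rate_cvg]).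

    It remains to send every configuration, and not only the concatenations, to a
    point of [Y] by a sliding block code ([block_decoder]). Blocks whose decoded
    patterns are coherent with the neighbours write them; far from all blocks the
    fixed point is used. The rest is filled ball by ball, the balls being attached
    to the blocks and treated in a bounded number of classes, so that the balls of
    one class do not interact. By the finite extension property a partial
    configuration that looks right in all windows becomes globally extendable
    when it is eroded by [g] ([extend_eroded]). Each step thus erodes what has
    been written, fills the balls of one class compatibly, and keeps the
    configuration locally right ([patch_locally_in]). The total erosion is
    bounded while the balls are as large as desired, so at the end everything is
    defined. On a concatenation of names the first step already writes the whole
    point, and it is left unchanged. *)

(** * Sup-norm balls and sliding block codes *)

Lemma latD {d} (u v : lattice d) i : (u + v) ord0 i = u ord0 i + v ord0 i :> int.
Proof. exact: mxE. Qed.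

Lemma latN {d} (u : lattice d) i : (- u) ord0 i = - u ord0 i :> int.
Proof. exact: mxE. Qed.

Lemma lat0 {d} i : (0%R : lattice d) ord0 i = 0 :> int.
Proof. exact: mxE. Qed.

Lemma latR {d} (f : 'I_d -> int) i : (\row_j f j) ord0 i = f i.
Proof. exact: mxE. Qed.

Definition latE := (@latD, @latN, @lat0, @latR).

Lemma lat_ext {d} (u v : lattice d) :
  (forall i, u ord0 i = v ord0 i) -> u = v.
Proof. by move=> uv; apply/rowP => i; exact: uv. Qed.

Definition sball {d} (k : nat) (u : lattice d) : Prop :=
  forall i, (`|u ord0 i| <= k)%N.

Lemma sballD {d} {k l} {u v : lattice d} :
  sball k u -> sball l v -> sball (k + l) (u + v).
Proof. by move=> ku lv i; have := ku i; have := lv i; rewrite latE; lia. Qed.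

Lemma sballN {d} {k} {u : lattice d} : sball k u -> sball k (- u).
Proof. by move=> ku i; have := ku i; rewrite latE; lia. Qed.

Lemma sball_le {d} {k l} {u : lattice d} : (k <= l)%N -> sball k u -> sball l u.
Proof. by move=> kl ku i; have := ku i; lia. Qed.

Lemma sball0 {d} k : sball k (0%R : lattice d).
Proof. by move=> i; rewrite latE. Qed.

Definition cube_offset {d k} (j : {ffun 'I_d -> 'I_(k.*2.+1)}) : lattice d :=
  \row_i ((j i : nat)%:Z - k%:Z).

Definition sball_fset d (k : nat) : {fset lattice d} :=
  [fset cube_offset j | j in {: {ffun 'I_d -> 'I_(k.*2.+1)}}]%fset.

Lemma in_sball_fset d k (u : lattice d) : (u \in sball_fset d k) <-> sball k u.
Proof.
have offB (j : {ffun 'I_d -> 'I_(k.*2.+1)}) : sball k (cube_offset j).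
  by move=> i; rewrite latE; have := ltn_ord (j i); lia.
split=> [/imfsetP[j _ ->] //|ku].
have lt i : (`|(u ord0 i + k%:Z)%R| < k.*2.+1)%N by have := ku i; lia.
apply/imfsetP; exists [ffun i => Ordinal (lt i)]; first by rewrite inE.
by apply: lat_ext => i; rewrite latE ffunE /=; have := ku i; lia.
Qed.

(** Sliding block codes. Comparing different sites of different configurations
    expresses locality and shift-equivariance by a single condition, which is
    stable by composition and makes sense for any type of symbols. *)
Definition sliding {d} {T U : Type} (R : nat)
    (Phi : (lattice d -> T) -> lattice d -> U) : Prop :=
  forall x x' s s', (forall u, sball R u -> x (s + u) = x' (s' + u)) ->
  Phi x s = Phi x' s'.

Lemma sliding_comp {d} {T U V : Type} {R R'}
    {Phi : (lattice d -> T) -> lattice d -> U}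
    {Psi : (lattice d -> U) -> lattice d -> V} :
  sliding R Phi -> sliding R' Psi -> sliding (R + R') (Psi \o Phi).
Proof.
move=> slPhi slPsi x x' s s' xx'; apply: slPsi => u uR'.
apply: slPhi => v vR; rewrite -!addrA; apply: xx'.
by rewrite addnC; exact: sballD.
Qed.

Lemma sliding_shift {d} {A B : finType} {R}
    {Phi : config d A -> config d B} (t : lattice d) x :
  sliding R Phi -> Phi (shift_by t x) = shift_by t (Phi x).
Proof.
move=> slPhi; apply/funext => s; rewrite [RHS]/shift_by; apply: slPhi => u _.
by rewrite /shift_by addrAC.
Qed.

Lemma continuous_ptws {T : topologicalType} {I : eqType}
    {K : topologicalType} (f : T -> {ptws I -> K}) :
  (forall i, continuous (fun x => f x i)) -> continuous f.
Proof.
move=> cf x; apply/cvg_sup => i.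
apply/cvg_image.
  by rewrite eqEsubset; split=> v // _; exists (fun=> v).
move=> V /= Vf; exists (@^~ i @^-1` V); first exact: (cf i x V).
by rewrite eqEsubset; split => [j [? + <-//]|j Vj]; exists (fun _ => j).
Qed.

(** The value at a site is constant on a cylinder, and cylinders are open. *)
Lemma sliding_continuous {d} {A B : finType} {R}
    {Phi : config d A -> config d B} : sliding R Phi -> continuous Phi.
Proof.
move=> slPhi; apply: continuous_ptws => s x V /= Vs.
have : \forall x' \near x, forall u, u \in sball_fset d R ->
    x' (s + u) = x (s + u).
  apply: (@filter_bigI _ _ (sball_fset d R)
    (fun u => [set x' : config d A | x' (s + u) = x (s + u)])) => u _.
  have := @proj_continuous _ (fun _ : lattice d => discrete_topology A)
    (s + u) x [set x (s + u)].
  by apply; apply/principal_filterP.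
apply: filterS => x' xx' /=.
have -> : Phi x' s = Phi x s; last exact: nbhs_singleton.
by apply: slPhi => u /in_sball_fset /xx'.
Qed.

(** * From locally admissible partial configurations to points of [Y] *)

Definition pattern_of {d} {A : finType} (S : {fset lattice d})
    (f : lattice d -> A) : pattern d A := [fmap s : S => f (val s)]%fmap.

Lemma pattern_ofE {d} {A : finType} (S : {fset lattice d}) (f : lattice d -> A) s :
  s \in S -> (pattern_of S f).[? s]%fmap = Some (f s).
Proof. by move=> sS; rewrite in_fnd ffunE. Qed.

Lemma pattern_of_dom {d} {A : finType} (S : {fset lattice d})
    (f : lattice d -> A) s a : (pattern_of S f).[? s]%fmap = Some a ->
  s \in S /\ a = f s.
Proof.
move=> e; have sS : s \in S.
  by apply/negPn/negP => sS; rewrite not_fnd in e.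
by split=> //; move: e; rewrite pattern_ofE // => -[].
Qed.

Lemma avoid_shift {d} {A : finType} (F : set (pattern d A)) t x :
  avoid F x -> avoid F (shift_by t x).
Proof.
move=> Fx w Fw [p wp]; apply: (Fx w Fw); exists (p + t) => s sw.
by rewrite wp // /shift_by addrA.
Qed.

Lemma finite_patterns_bounded {d} {A : finType} {F : set (pattern d A)} :
  finite_set F ->
  exists D, forall w, F w -> forall s, s \in domf w -> sball D s.
Proof.
move=> finF.
have bound (S : {fset lattice d}) : exists D, forall s, s \in S -> sball D s.
  exists (\max_(s : S) \max_i `|val s ord0 i|)%N => s sS i.
  apply: leq_trans (leq_bigmax (FSetSub sS)).
  exact: (leq_bigmax (F := fun i => `|s ord0 i|%N) i).
pose D (w : pattern d A) := projT1 (cid (bound (domf w))).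
exists (\max_(w <- fset_set F) D w)%N => w Fw s sw.
have : sball (D w) s by exact: (projT2 (cid (bound (domf w)))).
apply: sball_le; apply: leq_bigmax_seq => //.
by rewrite in_fset_set // inE.
Qed.

(** Local admissibility. As soon as [D] exceeds the radius of the forbidden
    patterns of [Y], none of them occurs in [w]. Asking for a witness in [Y]
    in each window, instead of the absence of patterns, is what survives when
    pieces of points of [Y] are glued. *)
Definition locally_in {d} {A : finType} (Y : set (config d A)) (D : nat)
    (w : lattice d -> option A) : Prop :=
  forall q, exists y, Y y /\
    forall u, sball D u -> forall a, w (q + u) = Some a -> y (q + u) = a.

(** The sites that remain when the domain of [w] is eroded by [k]. *)
Definition thick_at {d} {A : Type} (w : lattice d -> option A) (k : nat)
    (s : lattice d) : Prop := forall u, sball k u -> w (s + u) <> None.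

(** The limit of the [x n] along an ultrafilter takes at each site the value
    that it has for most [n]; it lies in [avoid F] because an occurrence of a
    forbidden pattern in the limit would occur in most [x n]. *)
Lemma avoid_compact {d} {A : finType} (F : set (pattern d A))
    (x : nat -> config d A) :
  (forall n, avoid F (x n)) ->
  exists y, avoid F y /\ forall s (P : set A), (\forall n \near \oo, P (x n s)) ->
    P (y s).
Proof.
move=> Fx; have [U [UU sU]] := ultraFilterLemma (@eventually_filter).
have [//|y yP] := @choice (lattice d) A (fun s a => U [set n | x n s = a]).
  move=> s; apply: contrapT => /forallNP no.
  have [n] : exists n, forall a, ~ x n s = a.
    apply: (@filter_ex _ U); apply: filter_forall => a.
    by have [/no|] := in_ultra_setVsetC [set n | x n s = a] UU.
  by move=> /(_ (x n s)).
exists y; split=> [w Fw [p wp]|s P /sU UP].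
  have : U (\bigcap_(s in [set` domf w]) [set n | x n (s + p) = y (s + p)]).
    by apply: filter_bigI => s _; exact: yP.
  move=> /(@filter_ex _ U)[n xn]; apply: (Fx n w Fw).
  by exists p => s sw; rewrite wp // xn.
by have [n [/= <-]] := @filter_ex _ U _ _ (filterI (yP s) UP).
Qed.

(** Infinite form of the finite extension property: eroding a locally
    admissible partial configuration by [g] leaves something that extends to
    a point. On finite pieces this is the hypothesis, and compactness does the
    rest. *)
Lemma extend_eroded {d} {A : finType} {Y : set (config d A)} {g} :
  extension_property g Y ->
  exists D, forall w, locally_in Y D w ->
  exists y, Y y /\ forall s, thick_at w g s -> w s = Some (y s).
Proof.
move=> [F [finF YF fep]].
have [D FD] := finite_patterns_bounded finF.
exists D => w wY; have [y0 [_ _]] := wY 0.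
pose f s := odflt (y0 0) (w s).
have fE s : w s <> None -> w s = Some (f s) by rewrite /f; case: (w s).
have wS n : exists x, Y x /\
    forall s, sball n s -> thick_at w g s -> w s = Some (x s).
  pose S := [fset s in sball_fset d n | `[< thick_at w g s >]]%fset.
  have inS s : s \in S <-> sball n s /\ thick_at w g s.
    rewrite !inE /=; split => [/andP[/in_sball_fset sn /asboolP ws] //|[sn ws]].
    by apply/andP; split; [exact/in_sball_fset|exact/asboolP].
  pose S' := [fset s in sball_fset d (n + g) |
    `[< exists t u, [/\ t \in S, sball g u & s = (t + u)%R] >]]%fset.
  have inS' s : s \in S' <-> exists t u, [/\ t \in S, sball g u & s = t + u].
    rewrite !inE /=; split=> [/andP[_ /asboolP] //|h].
    apply/andP; split; last exact/asboolP.
    by have [t [u [/inS[tn _] ug ->]]] := h; apply/in_sball_fset/sballD.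
  have wS' s : s \in S' -> w s = Some (f s).
    by move=> /inS' [t [u [/inS[_ wt] ug ->]]]; apply: fE; exact: wt.
  have SS' s : s \in S -> s \in S'.
    by move=> sS; apply/inS'; exists s, 0; split; rewrite ?addr0 //; exact: sball0.
  have [] := fep (pattern_of S f).
    exists (pattern_of S' f); split.
    - apply/seteqP; split=> s /=.
        move=> /inS' [t [u [tS ug ->]]]; exists t => //; exists u => // i.
        by have := ug i; lia.
      move=> [t tS [u ug <-]]; apply/inS'; exists t, u; split=> // i.
      by have := ug i; lia.
    - by move=> s sS; rewrite !pattern_ofE //; exact: SS'.
    - move=> v Fv [p vp]; have [y [Yy yw]] := wY p.
      move: Yy; rewrite YF => /(_ v Fv); apply; exists p => s sv.
      have := vp s sv; case vs : (v.[? s]%fmap) => [a|]; last first.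
        by move: vs; rewrite in_fnd.
      move=> /esym/pattern_of_dom[spS' ->]; congr Some; apply/esym.
      rewrite addrC; apply: yw; first exact: FD sv.
      by rewrite addrC; exact: wS'.
  move=> x [Yx [p xp]]; exists (shift_by p x); split.
    by move: Yx; rewrite YF; exact: avoid_shift.
  move=> s sn ws; have sS : s \in S by apply/inS.
  by rewrite wS'; [rewrite -xp// pattern_ofE|exact: SS'].
have [x xP] := choice wS.
have [n|y [Yy yP]] := @avoid_compact _ _ F x.
  by have [+ _] := xP n; rewrite YF.
exists y; split; first by rewrite YF.
move=> s ws; apply: (yP s (fun a => w s = Some a)).
exists (\max_i `|s ord0 i|)%N => // n /= sn; apply: (xP n).2 => // i.
exact: leq_trans (leq_bigmax (F := fun i => `|s ord0 i|%N) i) sn.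
Qed.

(** * Patching partial configurations around marked sites *)

Definition erode {d} {A : Type} (g : nat) (w : lattice d -> option A) s :
    option A :=
  if `[< thick_at w g s >] then w s else None.

Definition patch_offsets {d} {B : Type} (l : nat) (o : lattice d)
    (delta : lattice d -> option B) (s : lattice d) : set (lattice d) :=
  [set u | sball l u /\ delta (s - u - o) <> None].

Definition patch_points {d} {A : finType} (Y : set (config d A)) (g R : nat)
    (w : lattice d -> option A) (t : lattice d) : set (config d A) :=
  [set y | Y y /\
    forall u, sball R u -> thick_at w g (t + u) -> w (t + u) = Some (y u)].

(** Around [p + o], for each marked site [p], the configuration is overwritten
    on a ball of radius [l] by a point of [Y] that matches the eroded
    configuration on a larger ball; elsewhere it is eroded. Eroding first
    guarantees that such a point exists. The choice operator [xget] depends on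
    a set that a window determines, up to translation, so the operation is a
    sliding block code. *)
Definition patch {d} {A : finType} {B : Type} (Y : set (config d A))
    (y0 : config d A) (g l R : nat) (o : lattice d)
    (delta : lattice d -> option B) (w : lattice d -> option A) (s : lattice d) :
    option A :=
  let U := patch_offsets l o delta s in
  if `[< nonempty U >] then
    let u := xget (0%R : lattice d) U in
    Some (xget y0 (patch_points Y g R w (s - u)) u)
  else erode g w s.

Definition separated {d} {B : Type} (k : nat) (delta : lattice d -> option B) :=
  forall p p', delta p <> None -> delta p' <> None -> sball k (p - p') -> p = p'.

Section Patch.
Context {d : nat} {A : finType} {B : Type} {Y : set (config d A)}.
Context {y0 : config d A} {g D : nat} {l R : nat}.
Context {delta : lattice d -> option B}.
Hypothesis Yshift : forall t x, Y x -> Y (shift_by t x).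
Hypothesis Yext : forall w, locally_in Y D w ->
  exists y, Y y /\ forall s, thick_at w g s -> w s = Some (y s).
Hypothesis sepd : separated (l + D + (l + D)) delta.
Hypothesis R_large : (l + D + D <= R)%N.

Let patch_o o w := patch Y y0 g l R o delta w.

Lemma patch_pointP {w} t : locally_in Y D w ->
  patch_points Y g R w t (xget y0 (patch_points Y g R w t)).
Proof.
move=> /Yext [y [Yy yw]]; apply: xgetPex; exists (shift_by t y).
split; first exact: Yshift.
by move=> u _ /yw ->; rewrite /shift_by addrC.
Qed.

Lemma patch_in w {o s} : nonempty (patch_offsets l o delta s) ->
  exists u, patch_offsets l o delta s u /\
    patch_o o w s = Some (xget y0 (patch_points Y g R w (s - u)) u).
Proof.
move=> U0; exists (xget (0%R : lattice d) (patch_offsets l o delta s)).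
by split; [exact: xgetPex|rewrite /patch_o /patch asboolT].
Qed.

Lemma patch_out {w} {o} {s} : ~ nonempty (patch_offsets l o delta s) ->
  patch_o o w s = erode g w s.
Proof. by move=> U0; rewrite /patch_o /patch asboolF. Qed.

Lemma patch_keep {w} {o} {s} : locally_in Y D w -> thick_at w g s ->
  patch_o o w s = w s.
Proof.
move=> wY ws.
have [U0|/patch_out ->] := pselect (nonempty (patch_offsets l o delta s)).
  have [u [[ul _] ->]] := patch_in w U0; have [_ yP] := patch_pointP (s - u) wY.
  by rewrite -yP ?subrK //; apply: sball_le ul; lia.
by rewrite /erode asboolT.
Qed.

(** Gluing preserves local admissibility: a window of radius [D] meets the balls around at most one marked site, by
    separation. If it meets one, the point used there is a witness. *)
Lemma patch_locally_in {w} {o} : locally_in Y D w -> locally_in Y D (patch_o o w).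
Proof.
move=> wY q.
have [[v [vD [u [ul dt]]]]|nov] := pselect (exists v, sball D v /\
    exists u, patch_offsets l o delta (q + v) u); last first.
  have [y [Yy yw]] := wY q; exists y; split=> // v vD a.
  rewrite patch_out; last by move=> [u U]; apply: nov; exists v; split=> //; exists u.
  by rewrite /erode; case: asboolP => // _; exact: yw.
pose t := q + v - u.
have [Yy yP] := patch_pointP t wY.
exists (shift_by (- t) (xget y0 (patch_points Y g R w t))).
split=> [|v' v'D a]; first exact: Yshift.
have [U0|/patch_out ->] := pselect (nonempty (patch_offsets l o delta (q + v'))).
  have [u' [[u'l dt'] ->]] := patch_in w U0 => -[<-].
  have tt : q + v' - u' = t.
    apply: (addIr (- o)); apply: sepd => //.
    move=> i; have := vD i; have := ul i; have := v'D i; have := u'l i.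
    by rewrite !latE; lia.
  by rewrite tt /shift_by -tt opprB addrCA subrr addr0.
rewrite /erode; case: asboolP => // ws wa.
have e : q + v' = t + (q + v' - t) by rewrite addrCA subrr addr0.
have := yP (q + v' - t); rewrite -e wa => /(_ _ ws); rewrite /shift_by => Ea.
apply/esym/Some_inj/Ea => i.
have := vD i; have := ul i; have := v'D i.
by rewrite /t !latE; lia.
Qed.

Definition patch_all (os : seq (lattice d)) (w : lattice d -> option A) :=
  foldl (fun w o => patch_o o w) w os.

Lemma patch_all_locally_in {os} {w} :
  locally_in Y D w -> locally_in Y D (patch_all os w).
Proof. by elim: os w => //= o os IH w /(@patch_locally_in w o)/IH. Qed.

Lemma patch_all_keep {os} {w} {k} {s} : locally_in Y D w ->
  thick_at w (size os * g + k) s ->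
  thick_at (patch_all os w) k s /\ patch_all os w s = w s.
Proof.
elim: os w k s => [|o os IH] w k s wY ws //=.
have keep u : sball (size os * g + k) u -> patch_o o w (s + u) = w (s + u).
  move=> uk; apply: patch_keep => // v vg; rewrite -addrA; apply: ws.
  by apply: sball_le (sballD uk vg); rewrite /=; lia.
have keep0 : patch_o o w s = w s.
  by have := keep 0; rewrite addr0; apply; exact: sball0.
have [|ws' E] := IH (patch_o o w) k s (patch_locally_in wY).
  by move=> u uk; rewrite keep //; apply: ws; apply: sball_le uk; rewrite /=; lia.
by split=> //; rewrite -keep0.
Qed.

(** A ball patched at one step is eroded by [g] at each later step, hence the
    loss of radius. *)
Lemma patch_all_cover {os} {w} {o} {p} {s} {l'} : locally_in Y D w -> o \in os ->
  delta p <> None -> sball l' (s - p - o) -> (l' + size os * g <= l)%N ->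
  patch_all os w s <> None.
Proof.
elim: os w => //= o' os IH w wY; rewrite inE => /orP[/eqP <-|os_o] dp sl ll.
  have th : thick_at (patch_o o w) (size os * g + 0) s.
    move=> u ug; have [] // := @patch_in w o (s + u).
      exists (s + u - p - o); split=> [i|].
        by have := sl i; have := ug i; rewrite !latE; lia.
      have -> : s + u - (s + u - p - o) - o = p; last by [].
      by apply: lat_ext => i; rewrite !latE; lia.
    by move=> v [_ ->].
  have [+ _] := patch_all_keep (patch_locally_in wY) th.
  by move=> /(_ 0 (sball0 0)); rewrite addr0.
by apply: IH => //; [exact: patch_locally_in|lia].
Qed.

End Patch.

Lemma erode_sliding {d} {A : Type} (g k : nat) (w w' : lattice d -> option A)
    (s s' : lattice d) :
  (forall u, sball (k + g) u -> w (s + u) = w' (s' + u)) ->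
  forall u, sball k u -> thick_at w g (s + u) = thick_at w' g (s' + u).
Proof.
move=> ww u uk; apply/propext; split=> th v vg.
  by rewrite -addrA -ww ?addrA; [exact: th|exact: sballD].
by rewrite -addrA ww ?addrA; [exact: th|exact: sballD].
Qed.

(** The mark is carried along with the value so that the steps compose. *)
Definition patch_step {d} {A : finType} {B : Type} (Y : set (config d A))
    (y0 : config d A) (g l R : nat) (x : lattice d -> option B * option A)
    (o : lattice d) : lattice d -> option B * option A :=
  fun s => ((x s).1,
    patch Y y0 g l R o (fun s' => (x s').1) (fun s' => (x s').2) s).

Lemma patch_step_sliding {d} {A : finType} {B : Type} (Y : set (config d A))
    (y0 : config d A) (g l R : nat) (o : lattice d) :
  exists R', sliding R'
    (fun x : lattice d -> option B * option A => patch_step Y y0 g l R x o).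
Proof.
pose O := (\max_i `|o ord0 i|)%N.
have oO : sball O o by move=> i; exact: (leq_bigmax (F := fun i => `|o ord0 i|%N)).
exists (l + O + R + g)%N => x x' s s' xx'.
have d_eq u : sball l u -> (x (s - u - o)).1 = (x' (s' - u - o)).1.
  move=> ul; rewrite -!addrA xx' //.
  by apply: sball_le (sballD (sballN ul) (sballN oO)); lia.
have w_eq u : sball (l + R + g) u -> (x (s + u)).2 = (x' (s' + u)).2.
  by move=> ul; rewrite xx' //; apply: sball_le ul; lia.
congr pair; first by have := xx' 0 (sball0 _); rewrite !addr0 => ->.
have th u : sball (l + R) u ->
    thick_at (fun s => (x s).2) g (s + u) = thick_at (fun s => (x' s).2) g (s' + u).
  exact: (erode_sliding g (l + R) (fun s => (x s).2) (fun s => (x' s).2) s s').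
have UE : patch_offsets l o (fun s => (x s).1) s =
          patch_offsets l o (fun s => (x' s).1) s'.
  by apply/seteqP; split=> u [ul du]; split=> //; [rewrite -d_eq|rewrite d_eq].
rewrite /patch UE; case: asboolP => [U0|_]; last first.
  have := th 0 (sball0 _); have := w_eq 0 (sball0 _).
  by rewrite /erode !addr0 => -> ->.
have [ul _] := xgetPex (0%R : lattice d) U0.
set u := xget _ _ in ul *; congr (Some (xget y0 _ u)).
have tw v : sball R v ->
    thick_at (fun s => (x s).2) g (s - u + v) =
    thick_at (fun s => (x' s).2) g (s' - u + v) /\
    (x (s - u + v)).2 = (x' (s' - u + v)).2.
  move=> vR; rewrite -!addrA; split.
    by apply: th; apply: sballD => //; exact: sballN.
  by apply: w_eq; apply: sball_le (sballD (sballN ul) vR); lia.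
apply/seteqP; split=> y [Yy yP]; split=> // v vR; have [E1 E2] := tw v vR.
  by rewrite -E1 -E2; exact: yP.
by rewrite E1 E2; exact: yP.
Qed.

Lemma patch_steps_sliding {d} {A : finType} {B : Type} (Y : set (config d A))
    (y0 : config d A) (g l R : nat) (os : seq (lattice d)) :
  exists R', sliding R'
    (fun x : lattice d -> option B * option A => foldl (patch_step Y y0 g l R) x os).
Proof.
elim: os => [|o os [R1 IH]] /=.
  by exists 0%N => x x' s s' /(_ 0 (sball0 0)); rewrite !addr0.
have [R2 sl] := @patch_step_sliding d A B Y y0 g l R o.
by exists (R2 + R1)%N; exact: sliding_comp sl IH.
Qed.

Lemma patch_stepsE {d} {A : finType} {B : Type} (Y : set (config d A))
    (y0 : config d A) (g l R : nat) (os : seq (lattice d))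
    (delta : lattice d -> option B) (w : lattice d -> option A) :
  foldl (patch_step Y y0 g l R) (fun s => (delta s, w s)) os =
  fun s => (delta s, @patch_all d A B Y y0 g l R delta os w s).
Proof. by elim: os w => //= o os IH w; rewrite -IH. Qed.

(** * Decoding marked blocks into a point of [Y] *)

Definition inbox {d} (N k : nat) (u : lattice d) : Prop :=
  forall i, - k%:Z <= u ord0 i < N%:Z + k%:Z.

Lemma inbox_sball {d} {N k} {u : lattice d} : inbox N k u -> sball (N + k) u.
Proof. by move=> uk i; have := uk i; lia. Qed.

Section Seed.
Context {d : nat} {A : finType} {B : Type}.
Context (N c : nat) (dec : B -> config d A) (a0 : A).

(** Marks that conflict with a neighbour are ignored. The patterns of the others
    can be superimposed, and no mark is lost if all patterns come from one
    point. *)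
Definition coherent (delta : lattice d -> option B) (p : lattice d) (b : B) :
    Prop :=
  delta p = Some b /\
  forall z z' b', inbox N c z -> inbox N c z' -> delta (p + z - z') = Some b' ->
    dec b z = dec b' z'.

Definition seed_values (delta : lattice d -> option B) (s : lattice d) : set A :=
  [set a | exists u b, [/\ inbox N 0 u, coherent delta (s - u) b & a = dec b u]].

(** Near a coherent mark the decoded pattern is used, far from all marks the
    symbol [a0] of a fixed point. The sites that are near some box but not in a
    coherent one are left undefined: they keep the two cases apart by more than
    the size of a forbidden pattern. *)
Definition seed (delta : lattice d -> option B) (s : lattice d) : option A :=
  if `[< nonempty (seed_values delta s) >] then
    Some (xget a0 (seed_values delta s))
  else if `[< forall u, inbox N c u -> delta (s - u) = None >] then Some a0
  else None.

Lemma seed_sliding : sliding (4 * (N + c)) seed.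
Proof.
move=> delta delta' s s' dd'.
have imp (d1 d2 : lattice d -> option B) (s1 s2 : lattice d) :
    (forall u, sball (4 * (N + c)) u -> d1 (s1 + u) = d2 (s2 + u)) ->
    seed_values d1 s1 `<=` seed_values d2 s2.
  move=> dd a [u [b [uN [bs bco] ->]]].
  have u4 := inbox_sball uN.
  exists u, b; split=> //; split.
    by rewrite -dd //; apply: sballN; apply: sball_le u4; lia.
  move=> z z' b' zc z'c; have z4 := inbox_sball zc; have z'4 := inbox_sball z'c.
  move: (bco z z' b' zc z'c); rewrite -!addrA dd //.
  by move=> i; have := u4 i; have := z4 i; have := z'4 i; rewrite !latE; lia.
rewrite /seed.
have -> : seed_values delta s = seed_values delta' s'.
  by apply/seteqP; split; apply: imp => // u u4; rewrite dd'.
suff -> : (forall u, inbox N c u -> delta (s - u) = None) =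
          (forall u, inbox N c u -> delta' (s' - u) = None) by [].
have near u : inbox N c u -> delta (s - u) = delta' (s' - u).
  by move=> /inbox_sball u4; apply/dd'/sballN; apply: sball_le u4; lia.
by apply/propext; split=> dN u uN; [rewrite -near|rewrite near] => //; exact: dN.
Qed.

Context {delta : lattice d -> option B}.

Lemma seed_coherent s u b : (0 < N)%N ->
  inbox N 0 u -> coherent delta (s - u) b -> seed delta s = Some (dec b u).
Proof.
move=> N0 uN bco; rewrite /seed.
have V : seed_values delta s (dec b u) by exists u, b.
rewrite asboolT; last by exists (dec b u).
have [u' [b' [u'N [b's _] ->]]] := xgetPex a0 (ex_intro _ _ V).
have [_ agree] := bco; congr Some; apply/esym/agree.
- by move=> i; have := uN i; lia.
- by move=> i; have := u'N i; lia.
- by rewrite subrK.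
Qed.

Lemma seed_locally_in {Y : set (config d A)} {D} : (0 < N)%N -> (D + D <= c)%N ->
  (forall b, Y (dec b)) -> (forall t x, Y x -> Y (shift_by t x)) ->
  Y (fun=> a0) -> locally_in Y D (seed delta).
Proof.
move=> N0 Dc Ydec Yshift Y0 q.
have [[v [vD [u [b [uN bco]]]]]|none] := pselect (exists v, sball D v /\
    exists u b, inbox N 0 u /\ coherent delta (q + v - u) b); last first.
  exists (fun=> a0); split=> // v vD a; rewrite /seed asboolF.
    by case: asboolP => // _ [].
  move=> [_ [u [b [uN bco _]]]]; apply: none.
  by exists v; split=> //; exists u, b.
pose p := q + v - u.
exists (shift_by (- p) (dec b)); split=> [|v' v'D a]; first exact: Yshift.
have v'c : inbox N c (q + v' - p).
  move=> i; have := uN i; have := vD i; have := v'D i.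
  by rewrite /p !latE; lia.
rewrite /shift_by; have [bp agree] := bco.
have [[_ [u' [b' [u'N b'co _]]]]|V0] :=
    pselect (nonempty (seed_values delta (q + v'))).
  rewrite (seed_coherent _ _ _ N0 u'N b'co) => -[<-].
  have [b'p _] := b'co.
  apply: agree => //; first by move=> i; have := u'N i; lia.
  by rewrite -b'p /p; congr delta; apply: lat_ext => i; rewrite !latE; lia.
rewrite /seed asboolF //; case: asboolP => // /(_ (q + v' - p) v'c).
suff -> : q + v' - (q + v' - p) = p by rewrite bp.
by rewrite opprB addrCA subrr addr0.
Qed.

End Seed.

Definition patch_centre {d} (q : nat) (k : {ffun 'I_d -> 'I_3}) : lattice d :=
  \row_i (2 * q * k i)%N%:Z.

(** Marks that are [4 q] apart are decoded by a sliding block code with values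
    in [Y]. Each box of side [4 q], slightly thickened, is covered by [3 ^ d]
    balls of radius about [q]; this number does not depend on [q], so the total
    erosion is bounded, and the balls of one class are far apart since marks are.
    If all decoded patterns come from one point [y] and the boxes cover the
    lattice, the seed is already [y] and the patches do not alter it. *)
Lemma block_decoder {d} {A : finType} {Y : set (config d A)} {g} {y0} :
  (forall t x, Y x -> Y (shift_by t x)) -> extension_property g Y ->
  Y y0 -> fixed_point y0 ->
  exists c q0 : nat, forall q, (q0 <= q)%N ->
  forall (B : Type) (dec : B -> config d A), (forall b, Y (dec b)) ->
  exists R (Phi : (lattice d -> option B) -> config d A),
  [/\ sliding R Phi,
      forall delta, separated (4 * q).-1 delta -> Y (Phi delta) &
      forall delta y, separated (4 * q).-1 delta -> Y y ->
        (forall s, exists u, inbox (4 * q) 0 u /\ delta (s - u) <> None) ->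
        (forall p b, delta p = Some b ->
           forall u, inbox (4 * q) c u -> dec b u = y (p + u)) ->
        Phi delta = y].
Proof.
move=> Yshift /extend_eroded[D Yext] Yy0 fixy0.
have y0E : y0 = fun=> y0 0.
  by apply/funext => s; rewrite -{2}(fixy0 s) /shift_by add0r.
pose os q := [seq @patch_centre d q k | k <- enum {: {ffun 'I_d -> 'I_3}}].
pose m := #|{: {ffun 'I_d -> 'I_3}}|.
have szos q : size (os q) = m by rewrite size_map -cardE.
(* A window of radius [D] that meets a box lies in its thickening by [2 * D]. *)
pose c := (D + D)%N; exists c, (c + m * g + D + 1)%N => q q_large B dec Ydec.
(* A radius [q] would suffice for covering; [m * g] compensates the erosion. *)
pose l := (q + m * g)%N; pose R := (l + D + D)%N.
pose start (delta : lattice d -> option B) s :=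
  (delta s, seed (4 * q) c dec (y0 0) delta s).
pose Phi delta : config d A := fun s =>
  odflt (y0 0) (foldl (patch_step Y y0 g l R) (start delta) (os q) s).2.
have [R1 sl1] := @patch_steps_sliding d A B Y y0 g l R (os q).
have [R2 sl2] : exists R2, sliding R2 start.
  exists (4 * (4 * q + c))%N => x x' s s' xx'; rewrite /start.
  congr pair; first by have := xx' 0 (sball0 _); rewrite !addr0.
  exact: seed_sliding xx'.
exists (R2 + R1)%N, Phi.
have PhiE delta s : Phi delta s = odflt (y0 0)
    (@patch_all d A B Y y0 g l R delta (os q)
       (seed (4 * q) c dec (y0 0) delta) s).
  by rewrite /Phi /start patch_stepsE.
have N0 : (0 < 4 * q)%N by lia.
have seedY delta : locally_in Y D (seed (4 * q) c dec (y0 0) delta).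
  by apply: seed_locally_in => //; rewrite -y0E.
have sepl delta : @separated d B (4 * q).-1 delta ->
    separated (l + D + (l + D)) delta.
  by move=> sepd p p' dp dp' pp'; apply: sepd => //; apply: sball_le pp';
    rewrite /l; lia.
split=> [x x' s s' xx'|delta /sepl sepd|delta y /sepl sepd Yy cover decy].
- by have := sliding_comp sl2 sl1 x x' s s' xx'; rewrite /Phi /= => ->.
- pose w := patch_all (Y := Y) (y0 := y0) (g := g) (l := l) (R := R)
    (delta := delta) (os q) (seed (4 * q) c dec (y0 0) delta).
  have wY : locally_in Y D w by exact: patch_all_locally_in.
  suff w_total s : w s <> None.
    have [y [Yy yw]] := Yext _ wY.
    suff -> : Phi delta = y by [].
    apply/funext => s; rewrite PhiE -/w yw // => u _; exact: w_total.
  have [[u [p_u du]]|far] := pselect (exists u,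
      inbox (4 * q) (c + m * g) u /\ delta (s - u) <> None).
    (* Along each axis the centres are [0], [2 * q] and [4 * q]; one of them is
       within [q] of [u]. *)
    pose k := [ffun i => inord (if (u ord0 i < q%:Z)%R then 0
      else if (u ord0 i < (3 * q)%N%:Z)%R then 1 else 2)%N : 'I_3].
    rewrite /w; apply: (patch_all_cover Yshift Yext sepd (leqnn R) (seedY delta)
      (o := @patch_centre d q k) (p := s - u) (l' := q)) => //.
    - by apply: map_f; rewrite mem_enum.
    - rewrite opprB addrCA subrr addr0 => i; have := p_u i.
      rewrite /patch_centre !latE ffunE.
      by do 2?[case: ifPn => ?]; rewrite inordK //; lia.
    - by rewrite szos.
  have th : thick_at (seed (4 * q) c dec (y0 0) delta) (size (os q) * g + 0) s.
    move=> v vg; rewrite /seed; case: asboolP => // _.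
    case: asboolP => // -[] u uc; apply: contrapT => du; apply: far.
    exists (u - v); split.
      by move=> i; have := uc i; have := vg i; rewrite szos !latE; lia.
    by rewrite opprB addrA.
  have [+ _] := patch_all_keep (y0 := y0) Yshift Yext sepd (leqnn R)
    (seedY delta) th.
  by move=> /(_ 0 (sball0 0)); rewrite addr0.
- have seedE s : seed (4 * q) c dec (y0 0) delta s = Some (y s).
    have [u [uN]] := cover s; case db : (delta (s - u)) => [b|//] _.
    have uc : inbox (4 * q) c u by move=> i; have := uN i; lia.
    rewrite (seed_coherent _ _ _ _ _ u b) //.
      by rewrite (decy _ _ db) // subrK.
    split=> // z z' b' zc z'c db'.
    by rewrite (decy _ _ db) // (decy _ _ db') // subrK.
  apply/funext => s; rewrite PhiE.
  have th : thick_at (seed (4 * q) c dec (y0 0) delta) (size (os q) * g + 0) s.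
    by move=> u _; rewrite seedE.
  have [_ ->] := patch_all_keep (y0 := y0) Yshift Yext sepd (leqnn R)
    (seedY delta) th.
  by rewrite seedE.
Qed.

(** * Concatenating periodic blocks with a common collar *)

Lemma cube_ptE {d n} (k : cube d n) i : cube_pt k ord0 i = (k i : nat)%:Z.
Proof. by rewrite /cube_pt latE. Qed.

Lemma cube_pt_range {d n} (k : cube d n) i : 0 <= cube_pt k ord0 i < n%:Z.
Proof. by rewrite cube_ptE; have := ltn_ord (k i); lia. Qed.

Section Blocks.
Context {d : nat} {A : finType} {N : nat}.
Hypothesis N_gt0 : (0 < N)%N.

Lemma modz_ord_subproof (s : lattice d) i : (`|(s ord0 i %% N)%Z| < N)%N.
Proof.
have N0 : N%:Z != 0 by move: N_gt0; lia.
by have := ltz_mod (s ord0 i) N0; have := modz_ge0 (s ord0 i) N0; lia.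
Qed.

Definition cube_mod (s : lattice d) : cube d N :=
  [ffun i => Ordinal (modz_ord_subproof s i)].

Lemma cube_pt_mod (s : lattice d) i : cube_pt (cube_mod s) ord0 i = (s ord0 i %% N)%Z.
Proof.
rewrite cube_ptE ffunE /= gez0_abs // modz_ge0 //.
by move: N_gt0; lia.
Qed.

Lemma cube_mod_eq (s s' : lattice d) :
  (forall i, (s ord0 i = s' ord0 i %[mod N])%Z) -> cube_mod s = cube_mod s'.
Proof. by move=> ss; apply/ffunP => i; rewrite !ffunE; apply: val_inj; rewrite /= ss. Qed.

Lemma cube_mod_inj (s s' : lattice d) :
  cube_mod s = cube_mod s' -> forall i, (s ord0 i = s' ord0 i %[mod N])%Z.
Proof. by move=> ss i; rewrite -!cube_pt_mod ss. Qed.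

Lemma cube_ptK : cancel (@cube_pt d N) cube_mod.
Proof.
move=> k; apply/ffunP => i; apply: val_inj; rewrite ffunE /= cube_ptE.
by rewrite modz_nat /= modn_small.
Qed.

Lemma cube_mod_add (s u : lattice d) : cube_mod (cube_pt (cube_mod s) + u) = cube_mod (s + u).
Proof. by apply: cube_mod_eq => i; rewrite !latD cube_pt_mod modzDml. Qed.

Definition periodic (b : cube_pattern d N A) : config d A :=
  fun s => b (cube_mod s).

Definition block_window n (b : cube_pattern d N A) (p : cube d N) :
    cube_pattern d n A :=
  restrict_cube n (shift_by (cube_pt p) (periodic b)).

Lemma block_window_mod n b (s : lattice d) :
  block_window n b (cube_mod s) = restrict_cube n (shift_by s (periodic b)).
Proof.
apply/ffunP => k; rewrite !ffunE /shift_by /periodic.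
by rewrite addrC cube_mod_add addrC.
Qed.

Definition block_index (s : lattice d) : lattice d :=
  \row_i (s ord0 i %/ N)%Z.

Definition block_corner (z : lattice d) : lattice d :=
  \row_i (N%:Z * z ord0 i).

Definition concat_blocks (bz : lattice d -> cube_pattern d N A) : config d A :=
  fun s => bz (block_index s) (cube_mod s).

(** The region covered by the [n]-windows with corner in the block at the
    origin; it overlaps the next blocks in their collars only. *)
Definition in_span n (s : lattice d) : Prop :=
  forall i, 0 <= s ord0 i < (N + n)%N%:Z.

(** One-sided collars suffice, as a window extends in the positive directions
    from its corner. *)
Definition same_collar n (b b' : cube_pattern d N A) : Prop :=
  forall k : cube d N, (exists i, (k i < n)%N) -> b k = b' k.

(** Beyond its own block a window sees only collars of the neighbours, hence
    the concatenation looks like one periodic configuration. *)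
Lemma concat_blocksE n bz z s : (n <= N)%N ->
  (forall z z', same_collar n (bz z) (bz z')) -> in_span n s ->
  concat_blocks bz (block_corner z + s) = periodic (bz z) s.
Proof.
move=> nN col sn; rewrite /concat_blocks /periodic.
have -> : cube_mod (block_corner z + s) = cube_mod s.
  by apply: cube_mod_eq => i; rewrite !latE mulrC modzMDl.
have [[i si]|no] := pselect (exists i, N%:Z <= s ord0 i).
  apply: col; exists i; rewrite ffunE /=; have := sn i.
  have -> : (s ord0 i %% N)%Z = s ord0 i - N%:Z.
    have sni := sn i.
    by rewrite -{1}(subrK N%:Z (s ord0 i)) modzDr modz_small //; lia.
  by lia.
congr (bz _ _); apply: lat_ext => i; rewrite !latE.
have := sn i; have : ~ N%:Z <= s ord0 i by move=> h; apply: no; exists i.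
move=> iN iN'; rewrite mulrC divzMDl; last by move: N_gt0; lia.
by rewrite divz_small ?addr0 //; lia.
Qed.

Lemma block_corner_index (p : lattice d) :
  p = block_corner (block_index p) + cube_pt (cube_mod p).
Proof.
apply: lat_ext => i; rewrite latD cube_pt_mod !latE mulrC.
exact: divz_eq.
Qed.

Lemma concat_blocks_allowed n (F : {set cube_pattern d n A}) bz : (n <= N)%N ->
  (forall z z', same_collar n (bz z) (bz z')) ->
  (forall z p, block_window n (bz z) p \notin F) ->
  random_sft F (concat_blocks bz).
Proof.
move=> nN col allowed p.
suff -> : restrict_cube n (shift_by p (concat_blocks bz)) =
    block_window n (bz (block_index p)) (cube_mod p) by exact: allowed.
apply/ffunP => k; rewrite !ffunE /shift_by {1}(block_corner_index p) addrCA.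
rewrite (concat_blocksE n) // => i; rewrite latD.
by have := cube_pt_range k i; have := cube_pt_range (cube_mod p) i; lia.
Qed.

(** * Detecting the blocks *)

Context {n : nat} {W : {set cube_pattern d N A}}.
Hypothesis d_gt0 : (0 < d)%N.
Hypothesis n_leN : (n <= N)%N.
Hypothesis W_distinct : forall b, b \in W -> injective (block_window n b).
Hypothesis W_collar : forall b b', b \in W -> b' \in W -> same_collar n b b'.

(** A block is recognised together with the collars that follow it, so that its
    corner window and the corner windows of its neighbours are all visible. *)
Definition detect (x : config d A) (p : lattice d) : option (cube_pattern d N A) :=
  let b := restrict_cube N (shift_by p x) in
  if (b \in W) && `[< forall s, in_span n s -> x (p + s) = periodic b s >]
  then Some b else None.

Lemma detectP {x p b} : detect x p = Some b ->
  b \in W /\ forall s, in_span n s -> x (p + s) = periodic b s.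
Proof. by rewrite /detect; case: ifP => // /andP[bW /asboolP bx] [<-]. Qed.

Lemma detect_periodic {x p b} : b \in W ->
  (forall s, in_span n s -> x (p + s) = periodic b s) -> detect x p = Some b.
Proof.
move=> bW bx; have bE : restrict_cube N (shift_by p x) = b.
  apply/ffunP => k; rewrite ffunE /shift_by addrC bx /periodic ?cube_ptK // => i.
  by have := cube_pt_range k i; lia.
by rewrite /detect bE bW asboolT.
Qed.

Lemma detect_sliding : sliding (N + n) detect.
Proof.
move=> x x' s s' xx'; rewrite /detect.
have -> : restrict_cube N (shift_by s x) = restrict_cube N (shift_by s' x').
  apply/ffunP => k; rewrite !ffunE /shift_by addrC xx' 1?addrC // => i.
  by have := cube_pt_range k i; lia.
set b := restrict_cube _ _.
suff -> : (forall u, in_span n u -> x (s + u) = periodic b u) =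
    (forall u, in_span n u -> x' (s' + u) = periodic b u) by [].
have near u : in_span n u -> x (s + u) = x' (s' + u).
  by move=> us; apply: xx' => i; have := us i; lia.
by apply/propext; split=> h u us; [rewrite -near|rewrite near] => //; exact: h.
Qed.

(** If two detected blocks overlap, the window at the corner of the second one,
    read periodically, is a window of the first one. By the common collar it
    is also the corner window of the first one, so distinctness forces the two
    corners to agree. *)
Lemma detect_separated x : separated N.-1 (detect x).
Proof.
move=> p p'; case bp : (detect x p) => [b|//] _.
case bp' : (detect x p') => [b'|//] _ pp'.
have [bW bx] := detectP bp; have [b'W b'x] := detectP bp'.
have N0 : N%:Z != 0 by move: N_gt0; lia.
pose q := cube_pt (cube_mod (p' - p)).
have qE i : q ord0 i = p' ord0 i - p ord0 i \/
    q ord0 i = p' ord0 i - p ord0 i + N%:Z.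
  rewrite /q cube_pt_mod !latE.
  have := pp' i; rewrite !latE => small.
  have [ge0|lt0] := leP 0 (p' ord0 i - p ord0 i).
    by left; rewrite modz_small //; lia.
  by right; rewrite -modzDr modz_small //; lia.
have q_range i : 0 <= q ord0 i < N%:Z := cube_pt_range _ i.
have : cube_mod (p' - p) = cube_mod 0.
  apply: (W_distinct b bW); rewrite [RHS]block_window_mod.
  apply/ffunP => k; rewrite !ffunE {1 2}/shift_by -/q.
  have kn := cube_pt_range k.
  rewrite -(bx (cube_pt k + q)); last first.
    by move=> i; rewrite latD; have := kn i; have := q_range i; lia.
  have -> : p + (cube_pt k + q) = p' + (cube_pt k + (q - (p' - p))).
    by apply: lat_ext => i; rewrite !(latD, latN); lia.
  rewrite b'x; last first.
    move=> i; rewrite !(latD, latN); have := kn i.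
    by case: (qE i) => ->; lia.
  have -> : periodic b' (cube_pt k + (q - (p' - p))) = periodic b' (cube_pt k).
    rewrite /periodic; congr (b' _); apply: cube_mod_eq => i; rewrite !(latD, latN).
    case: (qE i) => ->; first by congr (modz _ _); lia.
    by rewrite -[RHS]modzDr; congr (modz _ _); lia.
  rewrite addr0; apply: W_collar => //; exists (Ordinal d_gt0).
  rewrite ffunE /= cube_ptE modz_nat modn_small; first exact: ltn_ord.
  exact: leq_trans (ltn_ord _) n_leN.
move=> pp; apply: lat_ext => i.
have q0 : q ord0 i = 0 by rewrite /q pp cube_pt_mod lat0 mod0z.
have := pp' i; rewrite !(latD, latN); have := qE i; rewrite q0.
by move: N_gt0 => N0' [] + small; lia.
Qed.

Lemma detect_concat bz p b : (forall z, bz z \in W) ->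
  detect (concat_blocks bz) p = Some b ->
  exists z, p = block_corner z /\ b = bz z.
Proof.
move=> bzW bp; exists (block_index p).
have bz_p : detect (concat_blocks bz) (block_corner (block_index p)) =
    Some (bz (block_index p)).
  apply: detect_periodic => // s ss.
  by rewrite (concat_blocksE n) // => z z'; apply: W_collar.
have pE : p = block_corner (block_index p).
  apply: (detect_separated (concat_blocks bz)); rewrite ?bp ?bz_p //.
  rewrite {1}(block_corner_index p) addrAC subrr add0r => i.
  by have := cube_pt_range (cube_mod p) i; lia.
by split=> //; move: bp; rewrite pE bz_p -pE => -[].
Qed.

End Blocks.

(** * Patterns of [Y] on boxes *)

Definition box_fset {d} (n : 'I_d -> nat) : {fset lattice d} :=
  [fset s in sball_fset d (\max_i n i) | `[< box n s >]]%fset.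

Lemma in_box_fset {d} (n : 'I_d -> nat) s : (s \in box_fset n) <-> box n s.
Proof.
rewrite !inE /=; split=> [/andP[_ /asboolP]//|sn].
apply/andP; split; last exact/asboolP.
apply/in_sball_fset => i; apply: leq_trans (leq_bigmax i (F := n)).
by have := sn i; lia.
Qed.

Definition language_fset {d} {A : finType} (Y : set (config d A))
    (n : 'I_d -> nat) : {fset pattern d A} := fset_set (language_on Y (box n)).

Lemma language_on_finite {d} {A : finType} (Y : set (config d A)) n :
  finite_set (language_on Y (box n)).
Proof.
pose f (h : {ffun box_fset n -> A}) : pattern d A := [fmap s : box_fset n => h s]%fmap.
apply: (@sub_finite_set _ _ (f @` [set: {ffun box_fset n -> A}])); last first.
  exact/finite_image/finite_finset.
move=> w [_ wS].
have wdom : domf w = box_fset n.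
  apply/fsetP => s; apply/idP/idP => [sw|/in_box_fset].
    by apply/in_box_fset; rewrite -wS.
  by rewrite -wS.
case: w wdom {wS} => S h /= SE; subst S; exists h => //.
apply/fmapP => s; have [sS|sS] := boolP (s \in box_fset n).
  by rewrite !in_fnd ffunE.
by rewrite !not_fnd.
Qed.

Lemma in_language_fset {d} {A : finType} {Y : set (config d A)} n w :
  (forall t x, Y x -> Y (shift_by t x)) ->
  w \in language_fset Y n <-> exists y, Y y /\ w = pattern_of (box_fset n) y.
Proof.
move=> Yshift; rewrite in_fset_set; last exact: language_on_finite.
rewrite inE; split=> [[[x [Yx [p wx]]] wS]|[y [Yy ->]]]; last first.
  split; last by apply/seteqP; split=> s /in_box_fset.
  exists y; split=> //; exists 0 => s sn.
  by rewrite pattern_ofE // addr0.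
exists (shift_by p x); split; first exact: Yshift.
apply/fmapP => s; have [sn|sn] := boolP (s \in box_fset n).
  rewrite pattern_ofE // wx //.
  by move/in_box_fset: sn; rewrite -wS.
rewrite !not_fnd //; apply: contra sn => sw.
by apply/in_box_fset; rewrite -wS.
Qed.

(** With at least as many blocks as patterns, each pattern of [Y] on the
    thickened box gets a block as its name. *)
Lemma decoding_exists {d} {A : finType} {Y : set (config d A)} {T : finType}
    (W : {set T}) (N c : nat) y0 : Y y0 ->
  (forall t x, Y x -> Y (shift_by t x)) ->
  (#|` language_fset Y (fun=> N + c.*2)%N| <= #|W|)%N ->
  exists dec : T -> config d A, (forall b, Y (dec b)) /\
    forall y, Y y -> exists b, b \in W /\ forall u, inbox N c u -> dec b u = y u.
Proof.
move=> Yy0 Yshift; set n := (fun=> (N + c.*2)%N) => LW.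
pose L := language_fset Y n.
have [w|r rP] := @choice (pattern d A) (config d A)
    (fun w y => Y y /\ (w \in L -> w = pattern_of (box_fset n) y)).
  have [wL|wL] := boolP (w \in L); last by exists y0; split.
  by have /(in_language_fset _ _ Yshift)[y [Yy ->]] := wL; exists y.
pose t : lattice d := \row_i c.+1%:Z.
pose w0 : pattern d A := pattern_of fset0 y0.
exists (fun b => shift_by t (r (nth w0 (enum_fset L) (index b (enum W))))).
split=> [b|y Yy]; first by apply: Yshift; have [] := rP (nth w0 (enum_fset L) (index b (enum W))).
pose w := pattern_of (box_fset n) (shift_by (- t) y).
have wL : w \in L.
  by apply/in_language_fset => //; exists (shift_by (- t) y); split=> //; exact: Yshift.
have iW : (index w (enum_fset L) < #|W|)%N.
  by apply: leq_trans LW; rewrite index_mem.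
have [b0 _] : exists b0, b0 \in W by apply/card_gt0P; exact: leq_ltn_trans iW.
exists (nth b0 (enum W) (index w (enum_fset L))); split.
  by rewrite -mem_enum mem_nth // -cardE.
move=> u uN; rewrite index_uniq ?enum_uniq -?cardE // nth_index // /shift_by.
have [_ /(_ wL) /(congr1 (fun v : pattern d A => v.[? u + t]%fmap))] := rP w.
have un : u + t \in box_fset n.
  by apply/in_box_fset => i; have := uN i; rewrite /n /t !latE; lia.
by rewrite !pattern_ofE // /shift_by addrK => -[].
Qed.

(** * A criterion for factoring onto [Y] *)

(** The factor map detects the blocks of [W] and decodes them. It is onto: a
    point of [Y] is the image of the concatenation of the names of its patterns,
    which lies in the shift since the blocks of [W] concatenate freely. *)
Lemma random_sft_factors {d} {A : finType} {Y : set (config d A)} {g} {y0} :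
  (0 < d)%N ->
  (forall t x, Y x -> Y (shift_by t x)) -> extension_property g Y ->
  Y y0 -> fixed_point y0 ->
  exists c q0 : nat, forall q n, (q0 <= q)%N -> (n <= 4 * q)%N ->
  forall (B : finType) (F : {set cube_pattern d n B})
    (N_gt0 : (0 < 4 * q)%N) (W : {set cube_pattern d (4 * q) B}),
  (forall b, b \in W -> injective (block_window N_gt0 n b)) ->
  (forall b b', b \in W -> b' \in W -> same_collar n b b') ->
  (forall b p, b \in W -> block_window N_gt0 n b p \notin F) ->
  (#|` language_fset Y (fun=> 4 * q + c.*2)%N| <= #|W|)%N ->
  factors_onto (random_sft F) Y.
Proof.
move=> d0 Yshift fep Yy0 fixy0.
have [c [q0 decoder]] := block_decoder Yshift fep Yy0 fixy0.
exists c, q0 => q n qq nN B F N0 W Wdist Wcol Wallowed LW.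
have [dec [Ydec decW]] := decoding_exists W _ _ _ Yy0 Yshift LW.
have [R [Phi [slPhi PhiY Phi_y]]] := decoder q qq _ dec Ydec.
have sl := sliding_comp (detect_sliding N0 d0 nN (W := W)) slPhi.
pose phi : config d B -> config d A := fun x => Phi (detect N0 (n := n) (W := W) x).
exists phi; split.
- by apply: continuous_subspaceT; exact: sliding_continuous sl.
- apply/seteqP; split=> [_ [x _ <-]|y Yy].
    by apply: PhiY; exact: (detect_separated N0 d0 nN).
  have [z|bz bzP] := @choice (lattice d) (cube_pattern d (4 * q) B)
      (fun z b => b \in W /\ forall u, inbox (4 * q) c u ->
        dec b u = y (block_corner (N := 4 * q) z + u)).
    have [b [bW by_]] := decW _ (Yshift (block_corner (N := 4 * q) z) _ Yy).
    by exists b; split=> // u /by_ ->; rewrite /shift_by addrC.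
  have bzW z : bz z \in W by have [] := bzP z.
  have col z z' : same_collar n (bz z) (bz z') by exact: Wcol.
  exists (concat_blocks N0 bz).
    by apply: concat_blocks_allowed => // z p; exact: Wallowed.
  apply: Phi_y => //; first exact: (detect_separated N0 d0 nN).
    move=> s; exists (cube_pt (cube_mod N0 s)); split.
      by move=> i; have := cube_pt_range (cube_mod N0 s) i; lia.
    have -> : s - cube_pt (cube_mod N0 s) = block_corner (N := 4 * q) (block_index (N := 4 * q) s).
      by rewrite {1}(block_corner_index N0 s) addrK.
    rewrite (detect_periodic N0 d0 nN (bzW (block_index (N := 4 * q) s))) // => u us.
    by rewrite (concat_blocksE N0 n).
  move=> p b /(detect_concat N0 d0 nN Wdist Wcol)-/(_ bzW)[z [-> ->]] u uc.
  by have [_ ->] := bzP z.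
- by move=> t x _; exact: sliding_shift sl.
Qed.

(** * Entropy as a limit *)

(** A point is determined on the box [n] by its patterns on the translates of
    the box [m] that tile a box containing it. *)
Lemma language_submult {d} {A : finType} {Y : set (config d A)}
    (m n k : 'I_d -> nat) (y0 : config d A) : (forall t x, Y x -> Y (shift_by t x)) ->
  (forall i, 0 < m i)%N -> (forall i, n i <= k i * m i)%N ->
  (#|` language_fset Y n| <= #|` language_fset Y m| ^ (\prod_i k i))%N.
Proof.
move=> Yshift m0 nkm.
have [w|r rP] := @choice (pattern d A) (config d A) (fun w y =>
    w \in language_fset Y n -> Y y /\ w = pattern_of (box_fset n) y).
  have [wL|wL] := boolP (w \in language_fset Y n).
    by have /(in_language_fset _ _ Yshift)[y] := wL; exists y.
  by exists y0.
pose K := {dffun forall i : 'I_d, 'I_(k i)}.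
pose corner (j : K) : lattice d := \row_i (m i * j i)%N%:Z.
have inL (w : language_fset Y n) (j : K) :
    pattern_of (box_fset m) (shift_by (corner j) (r (val w))) \in language_fset Y m.
  apply/in_language_fset => //.
  by have [Yr _] := rP _ (valP w); exists (shift_by (corner j) (r (val w))); split=> //; exact: Yshift.
pose f (w : language_fset Y n) : {ffun K -> language_fset Y m} :=
  [ffun j => FSetSub (inL w j)].
have f_inj : injective f.
  move=> w w' /ffunP ff; apply: val_inj.
  have [_ ->] := rP _ (valP w); have [_ ->] := rP _ (valP w').
  apply/fmapP => s; have [sn|sn] := boolP (s \in box_fset n); last first.
    by rewrite !not_fnd.
  rewrite !pattern_ofE //; congr Some; have {}sn := (in_box_fset n s).1 sn.
  have lt_k (t : lattice d) i : box n t -> (`|(t ord0 i - 1)%R| %/ m i < k i)%N.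
    move=> tn; rewrite ltn_divLR //; apply: leq_trans (nkm i).
    by have := tn i; lia.
  have lt i := lt_k s i sn.
  pose j : K := [ffun i => Ordinal (lt i)].
  have sm : s - corner j \in box_fset m.
    apply/in_box_fset => i; rewrite !latE ffunE /=; have := sn i.
    move: (s ord0 i : int) => z zn.
    have := divn_eq `|(z - 1)%R| (m i); have := ltn_pmod `|(z - 1)%R| (m0 i).
    by nia.
  have := ff j; rewrite !ffunE => /(congr1 val) /=.
  move=> /(congr1 (fun v : pattern d A => v.[? s - corner j]%fmap)).
  by rewrite !pattern_ofE // /shift_by subrK => -[].
have := leq_card f f_inj; rewrite !cardfE card_ffun card_dep_ffun.
by rewrite foldrE big_map big_enum; under eq_bigr do rewrite card_ord.
Qed.

#[global] Instance all_to_oo_filter d : ProperFilter (@all_to_oo d).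
Proof.
apply: filter_from_proper => [|N _]; last by exists (fun=> N).
apply: filter_from_filter => [|i j _ _]; first by exists 0%N.
exists (maxn i j) => // n /= ijn.
by split=> k; have := ijn k; rewrite geq_max => /andP[].
Qed.

Section EntropyLimit.
Context {R : realType} {d : nat} {A : finType} {Y : set (config d A)}.
Context {y0 : config d A}.
Hypothesis Yy0 : Y y0.
Hypothesis Yshift : forall t x, Y x -> Y (shift_by t x).

Definition log_count (n : 'I_d -> nat) : R := ln (#|` language_fset Y n|)%:R.

Definition entropy_rate (n : 'I_d -> nat) : R :=
  (\prod_(i < d) n i)%N%:R^-1 * log_count n.

Lemma language_fset_gt0 n : (0 < #|` language_fset Y n|)%N.
Proof.
rewrite cardfs_gt0; apply/fset0Pn; exists (pattern_of (box_fset n) y0).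
by apply/(in_language_fset _ _ Yshift); exists y0.
Qed.

Lemma log_count_ge0 n : 0 <= log_count n.
Proof. by apply: ln_ge0; rewrite ler1n language_fset_gt0. Qed.

Lemma entropy_rate_ge0 n : 0 <= entropy_rate n.
Proof. by rewrite mulr_ge0 ?invr_ge0 ?log_count_ge0. Qed.

Lemma entropy_rate_le (m n : 'I_d -> nat) (M : nat) :
  (forall i, 0 < m i)%N -> (forall i, m i * M.+1 <= n i)%N ->
  entropy_rate n <= entropy_rate m * (1 + harmonic M) ^+ d.
Proof.
move=> m0 mn.
have n0 i : (0 < n i)%N by apply: leq_trans (mn i); rewrite muln_gt0 m0.
pose k i := (n i %/ m i).+1.
have nk i : (n i <= k i * m i)%N by rewrite ltnW // ltn_ceil.
have := language_submult m n k y0 Yshift m0 nk => count_le.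
have log_le : log_count n <= (\prod_i k i)%N%:R * log_count m.
  rewrite mulr_natl -lnXn; last by rewrite ltr0n language_fset_gt0.
  rewrite ler_ln ?posrE -?natrX ?ltr0n ?expn_gt0 ?language_fset_gt0 //.
  by rewrite ler_nat.
have prod_gt0 (f : 'I_d -> nat) : (forall i, 0 < f i)%N ->
    0 < (\prod_i f i)%N%:R :> R.
  by move=> f0; rewrite ltr0n prodn_gt0.
have k_le : (\prod_i k i)%N%:R * (\prod_i m i)%N%:R <=
    (\prod_i n i)%N%:R * (1 + harmonic M) ^+ d :> R.
  rewrite -natrM -big_split /= !natr_prod.
  have -> : (1 + harmonic M) ^+ d = \prod_(i < d) (1 + harmonic M) :> R.
    by rewrite prodr_const card_ord.
  rewrite -big_split /=.
  apply: ler_prod => i _; rewrite ler0n /= mulrDr mulr1 /harmonic.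
  have : (k i * m i <= n i + m i)%N.
    by rewrite /k mulSn addnC leq_add2r leq_trunc_div.
  rewrite -(ler_nat R) natrD => /le_trans; apply; rewrite lerD2l.
  by rewrite ler_pdivlMr ?ltr0n // -natrM ler_nat.
rewrite /entropy_rate ler_pdivrMl ?prod_gt0 //.
apply: le_trans log_le _.
move: k_le; rewrite -ler_pdivlMr ?prod_gt0 // => k_le.
apply: le_trans (ler_wpM2r (log_count_ge0 m) k_le) _.
by rewrite le_eqVlt; apply/orP; left; apply/eqP; ring.
Qed.

(** Fekete's lemma in several variables: large boxes are tiled, with little
    waste, by translates of a box whose rate is nearly optimal, hence the rates
    converge to their infimum. *)
Lemma entropy_rate_cvg : exists l : R, 0 <= l /\ entropy_rate @ @all_to_oo d --> l.
Proof.
pose E := [set entropy_rate m | m in [set m : 'I_d -> nat | forall i, (0 < m i)%N]].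
have E0 : nonempty E by exists (entropy_rate (fun=> 1%N)), (fun=> 1%N).
have El : lbound E 0 by move=> _ [m _ <-]; exact: entropy_rate_ge0.
exists (inf E); split; first exact: lb_le_inf.
apply/cvgrPdist_lt => e e0.
have [_ [m m0 <-] me] := inf_adherent e0 (conj E0 (ex_intro _ 0 El)).
have : entropy_rate m * (1 + harmonic M) ^+ d @[M --> \oo] -->
    entropy_rate m * (1 + 0) ^+ d.
  apply: cvgMl_tmp.
  apply: (@continuous_cvg _ R R _ _ (fun M => 1 + harmonic M)
    (fun x : R => x ^+ d)); first exact: exprn_continuous.
  by apply: cvgD; [exact: cvg_cst|exact: cvg_harmonic].
rewrite addr0 expr1n mulr1 => /cvgr_lt /(_ _ me) [M _ /(_ M (leqnn M)) /= Me].
exists ((\max_i m i) * M.+1)%N => // n /= nM.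
have nm i : (m i * M.+1 <= n i)%N.
  by apply: leq_trans (nM i); rewrite leq_mul2r leq_bigmax orbT.
have n0 i : (0 < n i)%N by apply: leq_trans (nm i); rewrite muln_gt0 m0.
have lo : inf E <= entropy_rate n.
  by apply: ge_inf; [exists 0|exists n].
have hi := le_lt_trans (entropy_rate_le m n M m0 nm) Me.
by rewrite distrC ger0_norm ?subr_ge0 // ltrBlDl.
Qed.

Lemma entropyE : entropy R Y = lim ((EFin \o entropy_rate) @ @all_to_oo d).
Proof.
rewrite /entropy; set f := (fun n => _).
suff -> : f = EFin \o entropy_rate by [].
by apply/funext => n; rewrite /f lne_EFin ?ltr0n ?language_fset_gt0.
Qed.

(** Positivity of [x] comes from [Y] being nonempty; the bound on cubes only
    needs that the limit defining the entropy exists. *)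
Lemma entropy_lt_count (x : R) : (entropy R Y < x%:E)%E ->
  0 < x /\ exists h : R, [/\ 0 <= h, h < x &
    exists n0, forall n, (n0 <= n)%N ->
      (#|` language_fset Y (fun=> n)|)%:R <= expR (h * n%:R ^+ d) :> R].
Proof.
have [l [l0 cvg_l]] := entropy_rate_cvg.
have -> : entropy R Y = l%:E.
  rewrite entropyE; apply: cvg_lim; first exact: ereal_hausdorff.
  by apply: cvg_EFin; [exact: nearW|exact: cvg_l].
rewrite lte_fin => lx; split; first exact: le_lt_trans l0 lx.
pose h := (l + x) / 2.
exists h; split; [by rewrite /h; lra|by rewrite /h; lra|].
have /cvgr_lt /(_ h) [|N _ /= Nh] := cvg_l; first by rewrite /h; lra.
exists N.+1 => n nN; have := Nh (fun=> n) (fun=> ltnW nN).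
rewrite /entropy_rate prod_nat_const card_ord natrX => rate_lt.
rewrite -[leLHS]lnK ?posrE ?ltr0n ?language_fset_gt0 // ler_expR.
by move: rate_lt; rewrite mulrC ltr_pdivrMr ?exprn_gt0 ?ltr0n ?(leq_trans _ nN) // => /ltW.
Qed.

End EntropyLimit.

(** * Random sets of forbidden patterns *)

Definition spared {T : finType} (Q F : {set T}) : bool :=
  fintype.disjoint (mem Q) (mem F).

Section RandomSet.
Context {R : realType} {T : finType} {alpha : R}.
Hypothesis alpha01 : 0 <= alpha <= 1.

Definition weight (F : {set T}) : R :=
  alpha ^+ (#|T| - #|F|) * (1 - alpha) ^+ #|F|.

Lemma weight_ge0 F : 0 <= weight F.
Proof.
by case/andP: alpha01 => a0 a1; rewrite mulr_ge0 // exprn_ge0 // subr_ge0.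
Qed.

Lemma weight_prod F : weight F = \prod_t (if t \in F then 1 - alpha else alpha).
Proof.
rewrite /weight (bigID (mem F)) /= mulrC; congr (_ * _).
  rewrite (eq_bigr (fun=> 1 - alpha)) => [|t ->] //.
  by rewrite prodr_const.
rewrite (eq_bigr (fun=> alpha)) => [|t /negPf ->] //.
rewrite -(cardsC F) addKn prodr_const; congr (_ ^+ _).
by apply: eq_card => t; rewrite !inE.
Qed.

(** The sum is the expansion of a product over [T], with factor [alpha] on [Q]
    and [(1 - alpha) + alpha] elsewhere. *)
Lemma weight_disjoint (Q : {set T}) :
  \sum_(F : {set T} | spared Q F) weight F = alpha ^+ #|Q|.
Proof.
have -> : alpha ^+ #|Q| =
    \prod_t ((if t \in Q then 0 else 1 - alpha) + alpha).
  rewrite (bigID (mem Q)) /= [X in _ * X]big1 => [|t /negPf ->]; last first.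
    by rewrite subrK.
  rewrite mulr1 (eq_bigr (fun=> alpha)) => [|t ->]; last by rewrite add0r.
  by rewrite prodr_const.
rewrite bigA_distr big_mkcond; apply: eq_bigr => F _.
rewrite weight_prod; case: ifP => [QF|/negbT].
  apply: eq_bigr => t _; case: ifP => // tF.
  by rewrite (disjointFl QF tF).
rewrite /spared -finset.setI_eq0 => /set0Pn[t /setIP[tQ tF]].
by rewrite (bigD1 t) //= tF tQ mul0r.
Qed.

Lemma weight_sum : \sum_(F : {set T}) weight F = 1.
Proof.
rewrite -(expr0 alpha) -(@cards0 T) -weight_disjoint.
by apply: eq_bigl => F; rewrite /spared -finset.setI_eq0 finset.set0I eqxx.
Qed.

(** Chebyshev's inequality, applied to the number of indices [b] in [D] whose set
    [Q b] is spared entirely. *)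
Lemma second_moment {B : finType} (D : {set B}) (Q : B -> {set T}) (m : nat)
    (eps : R) :
  0 < alpha -> (0 < #|D|)%N -> (forall b, b \in D -> #|Q b| = m) ->
  \sum_(b in D) \sum_(b' in D) alpha ^+ #|Q b :|: Q b'| <=
    (#|D|%:R * alpha ^+ m) ^+ 2 * (1 + eps) ->
  \sum_(F : {set T} | #|[set b in D | spared (Q b) F]%SET|%:R < #|D|%:R * alpha ^+ m / 2)
    weight F <= 4 * eps.
Proof.
move=> a0 D0 Qm; set mu := #|D|%:R * alpha ^+ m => mom2.
pose Z (F : {set T}) : R := \sum_(b in D) (spared (Q b) F)%:R.
have ZE (F : {set T}) : #|[set b in D | spared (Q b) F]%SET|%:R = Z F.
  by rewrite /Z -natr_sum -big_mkcondr sum1_card cardsE.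
have mu0 : 0 < mu by rewrite mulr_gt0 ?ltr0n ?exprn_gt0.
have EZ : \sum_(F : {set T}) weight F * Z F = mu.
  rewrite (eq_bigr (fun F => \sum_(b in D) weight F * (spared (Q b) F)%:R)).
    rewrite exchange_big /= (eq_bigr (fun=> alpha ^+ m)) => [|b bD].
      by rewrite sumr_const /mu mulr_natl.
    rewrite -(Qm b bD) -weight_disjoint [RHS]big_mkcond; apply: eq_bigr => F _.
    by case: ifP; rewrite ?mulr1 ?mulr0.
  by move=> F _; rewrite mulr_sumr.
have EZ2 : \sum_(F : {set T}) weight F * Z F ^+ 2 =
    \sum_(b in D) \sum_(b' in D) alpha ^+ #|Q b :|: Q b'|.
  rewrite (eq_bigr (fun F => \sum_(b in D) \sum_(b' in D)
     weight F * ((spared (Q b) F)%:R * (spared (Q b') F)%:R))).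
    rewrite exchange_big; apply: eq_bigr => b _.
    rewrite exchange_big; apply: eq_bigr => b' _ /=.
    rewrite -weight_disjoint [RHS]big_mkcond; apply: eq_bigr => F _.
    rewrite -natrM mulnb /spared -!finset.setI_eq0 finset.setIUl finset.setU_eq0.
    by case: ifP; rewrite ?mulr1 ?mulr0.
  move=> F _; rewrite expr2 /Z mulr_suml mulr_sumr; apply: eq_bigr => b _.
  by rewrite !mulr_sumr.
have var : \sum_(F : {set T}) weight F * (Z F - mu) ^+ 2 <= mu ^+ 2 * eps.
  have -> : \sum_(F : {set T}) weight F * (Z F - mu) ^+ 2 =
      \sum_(F : {set T}) weight F * Z F ^+ 2 - mu ^+ 2.
    rewrite (eq_bigr (fun F => weight F * Z F ^+ 2 - mu * 2 * (weight F * Z F)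
      + mu ^+ 2 * weight F)); last by move=> F _; ring.
    rewrite !big_split /= -!mulr_sumr sumrN -mulr_sumr EZ weight_sum; ring.
  by rewrite EZ2 lerBlDl; apply: le_trans mom2 _; rewrite mulrDr mulr1.
have mu2 : 0 < mu ^+ 2 / 4 by rewrite divr_gt0 ?exprn_gt0.
rewrite -(ler_pM2l mu2); apply: le_trans (_ : mu ^+ 2 * eps <= _); last first.
  by rewrite le_eqVlt; apply/orP; left; apply/eqP; field.
apply: le_trans var; rewrite mulr_sumr big_mkcond; apply: ler_sum => F _.
case: ifP => [|_]; last by rewrite mulr_ge0 ?weight_ge0 ?sqr_ge0.
rewrite ZE => ZF; rewrite mulrC ler_wpM2l ?weight_ge0 //; nra.
Qed.

End RandomSet.

(** * Counting blocks *)

Lemma card_determined {T A : finType} (S : {set {ffun T -> A}}) (C : {set T}) :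
  (forall f f', f \in S -> f' \in S -> (forall t, t \notin C -> f t = f' t) ->
    f = f') ->
  (#|S| <= #|A| ^ (#|T| - #|C|))%N.
Proof.
move=> det; have [->|[f0 _]] := finset.set_0Vmem S; first by rewrite cards0.
have [t _|C0] := pickP (fun t : T => true); last first.
  have -> : (#|T| - #|C| = #|T|)%N.
    by rewrite (eq_card0 (A := T)) // => t; have := C0 t.
  by rewrite -card_ffun max_card.
pose a0 := f0 t.
pose g (f : {ffun T -> A}) : {ffun T -> A} := [ffun t => if t \in C then a0 else f t].
rewrite -(card_in_imset (f := g)) => [|f f' fS f'S /ffunP gg]; last first.
  apply: det => // u uC; have := gg u; rewrite !ffunE.
  by rewrite (negPf uC).
have -> : (#|T| - #|C| = #|~: C|)%N by rewrite -(cardsC C) addKn.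
rewrite -(card_pffun_on a0 (mem (~: C)) (mem A)).
apply: subset_leq_card; apply/fintype.subsetP => h /imsetP[f _ ->].
apply/pffun_onP; split=> //; apply/fintype.subsetP => u.
by rewrite !inE ffunE; case: (u \in C); rewrite ?eqxx.
Qed.

Lemma card_bigcup_le {I T : finType} (S : I -> {set T}) m :
  (forall i, #|S i| <= m)%N -> (#|(\bigcup_i S i)%SET| <= #|I| * m)%N.
Proof.
move=> Sm; rewrite -sum_nat_const.
apply: (@leq_trans (\sum_i #|S i|)); last exact: leq_sum.
elim/big_rec2: _ => [|i n U _ IH]; first by rewrite cards0.
by apply: leq_trans (leq_card_setU _ _) _; rewrite leq_add2l.
Qed.

Section Counting.
Context {d : nat} {A : finType} {N : nat} (N_gt0 : (0 < N)%N).

Lemma card_cube n : #|{: cube d n}| = (n ^ d)%N.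
Proof. by rewrite card_ffun !card_ord. Qed.

Lemma card_cube_pattern n : #|{: cube_pattern d n A}| = (#|A| ^ (n ^ d))%N.
Proof. by rewrite card_ffun card_cube. Qed.

Lemma cube_shift_inj {n} (s : lattice d) : (n <= N)%N ->
  injective (fun k : cube d n => cube_mod N_gt0 (cube_pt k + s)).
Proof.
move=> nN k k' /cube_mod_inj kk; apply/ffunP => i; apply: val_inj.
have := kk i; rewrite !latD !cube_ptE.
move=> /eqP; rewrite eqz_modDr !modz_nat !modn_small ?(leq_trans (ltn_ord _) nN) //.
by move=> /eqP [].
Qed.

Lemma block_windowE n (b : cube_pattern d N A) p (r : cube d n) :
  block_window N_gt0 n b p r = b (cube_mod N_gt0 (cube_pt r + cube_pt p)).
Proof. by rewrite ffunE. Qed.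

Definition axis_pt (i : 'I_d) (r : nat) : lattice d :=
  \row_j (if j == i then r%:Z else 0).

(** Running along an axis in which [p] and [p'] differ, equality of the two
    windows determines the line at [p'] from the rest of the block: the sites
    of that line are copied from the line at [p], which trails behind. *)
Lemma card_repeat_along n (p p' : cube d N) (i : 'I_d) : (n.*2 <= N)%N ->
  0 < ((cube_pt p' ord0 i - cube_pt p ord0 i)%R %% N)%Z ->
  ((cube_pt p' ord0 i - cube_pt p ord0 i)%R %% N)%Z + n%:Z <= N%:Z ->
  (#|[set b : cube_pattern d N A | block_window N_gt0 n b p == block_window N_gt0 n b p']%SET|
    <= #|A| ^ (N ^ d - n))%N.
Proof.
set e := (modz _ _) => nN e0 eN.
pose line (r : 'I_n) := cube_mod N_gt0 (axis_pt i r + cube_pt p').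
have lineE (b : cube_pattern d N A) (r : 'I_n) :
    block_window N_gt0 n b p = block_window N_gt0 n b p' ->
    b (line r) = b (cube_mod N_gt0 (axis_pt i r + cube_pt p)).
  have n0 : (0 < n)%N by exact: leq_ltn_trans (ltn_ord r).
  pose k : cube d n := [ffun j => if j == i then r else Ordinal n0].
  move=> /ffunP /(_ k); rewrite !block_windowE.
  have -> : cube_pt k = axis_pt i r.
    by apply: lat_ext => j; rewrite cube_ptE ffunE latE; case: eqP.
  by move=> ->.
have line_mod (r r' : 'I_n) : cube_mod N_gt0 (axis_pt i r + cube_pt p) = line r' ->
    (r' < r)%N.
  move=> /cube_mod_inj /(_ i); rewrite !latD !latR !eqxx => rr.
  move/eqP: rr; rewrite eqz_mod_dvd => /dvdzP[z].
  have := divz_eq (cube_pt p' ord0 i - cube_pt p ord0 i) N.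
  rewrite -/e !cube_ptE; move: (_ %/ _)%Z => z'.
  move: (p i : nat) (p' i : nat) => a a' dE zE.
  have wE : (z + z') * N%:Z = r%:Z - r'%:Z - e by lia.
  have := ltn_ord r; have := ltn_ord r'; move: (z + z') wE => w wE r'n rn.
  have w0 : w = 0.
    have [w_lt|w_gt|//] := ltgtP w 0; exfalso.
      have : w * N%:Z <= -1 * N%:Z by apply: ler_wpM2r; lia.
      by rewrite wE; lia.
    have : 1 * N%:Z <= w * N%:Z by apply: ler_wpM2r; lia.
    by rewrite wE; lia.
  by move: wE; rewrite w0; lia.
have line_inj : injective line.
  move=> r r' /cube_mod_inj /(_ i) /eqP; rewrite !latD !latR eqxx eqz_modDr.
  have rN (q : 'I_n) : (q < N)%N by apply: leq_trans (ltn_ord q) _; lia.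
  by rewrite !modz_nat !modn_small // => /eqP [] /val_inj.
pose L : {set cube d N} := [set line r | r in 'I_n]%SET.
have cardL : #|L| = n by rewrite card_imset // card_ord.
rewrite -[X in (_ - X)%N]cardL -card_cube; apply: card_determined => b b'.
rewrite !inE => /eqP bp /eqP b'p off; apply/ffunP => t.
have [/imsetP[r _ ->{t}]|/off //] := boolP (t \in L).
have [m] := ubnP (r : nat); elim: m r => // m IH r rm.
rewrite !lineE //; set t := cube_mod _ _.
have [/imsetP[r' _ tr']|/off //] := boolP (t \in L).
rewrite tr'; apply: IH.
exact: leq_trans (line_mod r r' tr') rm.
Qed.

Lemma card_repeat n (p p' : cube d N) : (n.*2 <= N)%N -> p != p' ->
  (#|[set b : cube_pattern d N A | block_window N_gt0 n b p == block_window N_gt0 n b p']%SET|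
    <= #|A| ^ (N ^ d - n))%N.
Proof.
move=> nN pp; have [i ppi] : exists i, p i != p' i.
  apply/existsP; apply: contraNT pp; rewrite negb_exists => /forallP pp.
  by apply/eqP/ffunP => i; apply/eqP/negPn.
have modE (k k' : cube d N) :
    ((cube_pt k' ord0 i - cube_pt k ord0 i)%R %% N)%Z =
    if (k i <= k' i)%N then (k' i)%:Z - (k i)%:Z
    else (k' i)%:Z - (k i)%:Z + N%:Z.
  rewrite !cube_ptE; have := ltn_ord (k i); have := ltn_ord (k' i).
  move: (k i : nat) (k' i : nat) => a a' a'N aN.
  by case: ifP => aa'; [rewrite modz_small //|rewrite -modzDr modz_small //]; lia.
have neq : (p i : nat) <> p' i by move=> /val_inj; apply/eqP.
have [small|large] := leqP (`|modz (cube_pt p' ord0 i - cube_pt p ord0 i) N| + n) N.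
  by apply: (card_repeat_along n p p' i) => //; move: small; rewrite modE;
    have := ltn_ord (p i); have := ltn_ord (p' i); case: ifP; lia.
rewrite (_ : finset _ = [set b : cube_pattern d N A |
  block_window N_gt0 n b p' == block_window N_gt0 n b p]%SET); last first.
  by apply/finset.setP => b; rewrite !inE eq_sym.
by apply: (card_repeat_along n p' p i) => //; move: large; rewrite !modE;
  have := ltn_ord (p i); have := ltn_ord (p' i); do 2?[case: ifP]; lia.
Qed.

Definition distinct_blocks n : {set cube_pattern d N A} :=
  [set b | injectiveb (block_window N_gt0 n b)]%SET.

(** A repeated window costs a factor [#|A| ^ n], which beats the number of pairs
    of positions. *)
Lemma card_distinct n : (n.*2 <= N)%N ->
  (#|A| ^ (N ^ d) <=
    #|distinct_blocks n| + (N ^ d * N ^ d) * #|A| ^ (N ^ d - n))%N.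
Proof.
move=> nN.
pose S (pp : cube d N * cube d N) : {set cube_pattern d N A} :=
  if pp.1 == pp.2 then finset.set0 else
  [set b : cube_pattern d N A | block_window N_gt0 n b pp.1 == block_window N_gt0 n b pp.2]%SET.
rewrite -card_cube_pattern -(cardsC (distinct_blocks n)) leq_add2l.
apply: (@leq_trans #|(\bigcup_pp S pp)%SET|).
  apply: subset_leq_card; apply/fintype.subsetP => b; rewrite !inE.
  move=> /injectivePn[p [p' pp' bpp']]; apply/bigcupP; exists (p, p') => //.
  by rewrite /S /= (negPf pp') inE bpp'.
apply: leq_trans (card_bigcup_le S (#|A| ^ (N ^ d - n)) _) _.
  move=> [p p']; rewrite /S /=; case: eqVneq => [|pp]; first by rewrite cards0.
  exact: card_repeat.
by rewrite card_prod !card_cube.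
Qed.

End Counting.

(** * Pairs of blocks with common windows *)

Section SharedWindows.
Context {R : realType} {d : nat} {A : finType} {n N : nat} (N_gt0 : (0 < N)%N).
Context (h K : nat).
Hypothesis h_gt0 : (0 < h)%N.
Hypothesis N_Kh : (N <= K * h)%N.
Hypothesis h_n : (h.*2.-1 <= n)%N.
Hypothesis n_N : (n <= N)%N.

Local Notation block := (cube_pattern d N A).
Local Notation win := (block_window N_gt0 n).

Definition windows (b : block) : {set cube_pattern d n A} :=
  [set win b p | p : cube d N]%SET.

Definition in_cell (j : cube d K) (p : cube d N) : bool :=
  [forall i, p i %/ h == j i]%N.

Lemma cell_of (p : cube d N) : exists j, in_cell j p.
Proof.
have lt i : (p i %/ h < K)%N.
  by rewrite ltn_divLR //; exact: leq_trans (ltn_ord _) N_Kh.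
by exists [ffun i => Ordinal (lt i)]; apply/forallP => i; rewrite ffunE.
Qed.

Lemma same_cell_close {j} {p p' : cube d N} : in_cell j p -> in_cell j p' ->
  forall i, (p i < p' i + h)%N.
Proof.
move=> /forallP jp /forallP jp' i.
have /eqP pj := jp i; have /eqP pj' := jp' i.
have := divn_eq (p i) h; have := divn_eq (p' i) h; rewrite pj pj'.
have := ltn_pmod (p i) h_gt0; have := ltn_pmod (p' i) h_gt0; lia.
Qed.

(** The torus is cut into [K ^ d] cells of side [h]. In each cell where [b'] has
    a window of [b], one such window and its position in [b] are recorded. There
    are few records, and yet they control all the common windows: those of a
    cell lie within [h] of the recorded one. *)
Definition sharing (b b' : block) : {ffun cube d K -> option (cube d N * cube d N)} :=
  [ffun j => [pick pp : cube d N * cube d N |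
     in_cell j pp.1 && (win b' pp.1 == win b pp.2)]].

Definition shared_sites (sg : {ffun cube d K -> option (cube d N * cube d N)}) :
    {set cube d N} :=
  [set t | [exists j, if sg j is Some (p, _) then
     [exists r : cube d n, t == cube_mod N_gt0 (cube_pt r + cube_pt p)]
     else false]]%SET.

Lemma sharingP b b' j p q : sharing b b' j = Some (p, q) ->
  in_cell j p /\ win b' p = win b q.
Proof. by rewrite ffunE; case: pickP => // -[p1 q1] /= /andP[cp /eqP w] [<- <-]. Qed.

Lemma mem_shared_sites b b' t : t \in shared_sites (sharing b b') ->
  exists j p q (r : cube d n), sharing b b' j = Some (p, q) /\
    t = cube_mod N_gt0 (cube_pt r + cube_pt p).
Proof.
rewrite inE => /existsP[j]; case e : (sharing b b' j) => [[p q]|] //.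
by move=> /existsP[r /eqP ->]; exists j, p, q, r.
Qed.

Lemma shared_sites_mem b b' j p q (r : cube d n) : sharing b b' j = Some (p, q) ->
  cube_mod N_gt0 (cube_pt r + cube_pt p) \in shared_sites (sharing b b').
Proof. by move=> e; rewrite inE; apply/existsP; exists j; rewrite e; apply/existsP; exists r. Qed.

Lemma shared_in_cell b b' p q : win b' p = win b q ->
  exists j p' q', [/\ in_cell j p, in_cell j p' & sharing b b' j = Some (p', q')].
Proof.
move=> w; have [j jp] := cell_of p; exists j.
case e : (sharing b b' j) => [[p' q']|].
  by have [jp' _] := sharingP _ _ _ _ _ e; exists p', q'.
move: e; rewrite ffunE; case: pickP => // /(_ (p, q)) /=.
by rewrite jp w eqxx.
Qed.

(** Shifting a position by [h - 1] in all directions moves it inside the window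
    recorded for its cell. *)
Lemma card_shared_windows b b' :
  (#|windows b :&: windows b'| <= #|shared_sites (sharing b b')|)%N.
Proof.
pose P := [set p | win b' p \in windows b]%SET.
apply: (@leq_trans #|P|).
  apply: leq_trans (leq_imset_card (win b') P).
  apply: subset_leq_card; apply/fintype.subsetP => w /finset.setIP[wb /imsetP[p _ wE]].
  by apply/imsetP; exists p => //; rewrite inE -wE.
pose s : lattice d := \row_i (h.-1)%:Z.
rewrite -(card_imset P (cube_shift_inj N_gt0 s (leqnn _))).
suff shift_in (p : cube d N) : p \in P ->
    cube_mod N_gt0 (cube_pt p + s) \in shared_sites (sharing b b').
  by apply: subset_leq_card; apply/fintype.subsetP => t /imsetP[p /shift_in + ->].
rewrite inE => /imsetP[q _ w].
have [j [p' [q' [jp jp' e]]]] := shared_in_cell _ _ _ _ w.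
have close := same_cell_close jp jp'; have close' := same_cell_close jp' jp.
have r_lt i : (p i + h.-1 - p' i < n)%N.
  by have := close i; have := close' i; move: h_n h_gt0; lia.
pose r : cube d n := [ffun i => Ordinal (r_lt i)].
suff -> : cube_pt p + s = cube_pt r + cube_pt p' by exact: shared_sites_mem e.
apply: lat_ext => i; rewrite !latD !cube_ptE ffunE latE /=.
by have := close i; have := close' i; move: h_gt0; lia.
Qed.

Lemma card_shared_sites_ge b b' : windows b :&: windows b' != finset.set0 ->
  (n ^ d <= #|shared_sites (sharing b b')|)%N.
Proof.
move=> /set0Pn[w /finset.setIP[/imsetP[q _ wq] /imsetP[p _ wp]]].
have [|j [p' [q' [_ _ e]]]] := shared_in_cell b b' p q; first by rewrite -wp.
have inj := cube_shift_inj N_gt0 (cube_pt p') n_N.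
rewrite -(card_cube n) -cardsT -(card_imset _ inj).
apply: subset_leq_card; apply/fintype.subsetP => t /imsetP[r _ ->].
exact: shared_sites_mem e.
Qed.

(** Given the record, the recorded windows of [b'] are copied from [b]. *)
Lemma card_same_sharing b b1 :
  (#|[set b' : block | sharing b b' == sharing b b1]%SET| <=
    #|A| ^ (N ^ d - #|shared_sites (sharing b b1)|))%N.
Proof.
rewrite -(card_cube N); apply: card_determined => b' b''.
rewrite !inE => /eqP e' /eqP e'' off; apply/ffunP => t.
have [|/off //] := boolP (t \in shared_sites (sharing b b1)).
move=> /mem_shared_sites[j [p [q [r [e ->]]]]].
have [_ w'] := sharingP b b' j p q (etrans (congr1 (fun f : {ffun _ -> _} => f j) e') e).
have [_ w''] := sharingP b b'' j p q (etrans (congr1 (fun f : {ffun _ -> _} => f j) e'') e).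
by rewrite -!(block_windowE N_gt0) w' w''.
Qed.

(** A record whose windows cover [c] sites allows [#|A| ^ (N ^ d - c)] blocks, and
    the number of common windows is at most [c]; so it contributes at most
    [#|A| ^ (N ^ d) * beta ^ (- c)] with [beta = alpha * #|A|]. A nonempty record
    covers at least one window, and the number of records is polynomial in [N]. *)
Lemma sum_shared_windows (alpha : R) b : 0 < alpha <= 1 -> 1 <= alpha * #|A|%:R ->
  \sum_(b' : block | windows b :&: windows b' != finset.set0)
     alpha^-1 ^+ #|windows b :&: windows b'| <=
  ((N ^ d * N ^ d).+1 ^ (K ^ d))%N%:R * (#|A| ^ (N ^ d))%N%:R *
    (alpha * #|A|%:R)^-1 ^+ (n ^ d).
Proof.
move=> /andP[a0 a1] beta1; set beta := alpha * _ in beta1 *.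
have beta0 : 0 < beta by exact: lt_le_trans beta1.
have A0 : 0 < #|A|%:R :> R by move: beta0; rewrite pmulr_rgt0.
rewrite (partition_big (sharing b) predT) //=.
pose M : R := (#|A| ^ (N ^ d))%N%:R * beta^-1 ^+ (n ^ d).
have M0 : 0 <= M by rewrite mulr_ge0 // exprn_ge0 // invr_ge0 ltW.
apply: (@le_trans _ _ (\sum_(sg : {ffun cube d K -> option (cube d N * cube d N)}) M)).
  apply: ler_sum => sg _.
  have [b1 /andP[b1w /eqP b1s]|none] := pickP (fun b' : block =>
      (windows b :&: windows b' != finset.set0) && (sharing b b' == sg)); last first.
    by rewrite big_pred0.
  set c := #|shared_sites sg|.
  have nc : (n ^ d <= c)%N by rewrite /c -b1s card_shared_sites_ge.
  have cN : (c <= N ^ d)%N by rewrite -(card_cube N) max_card.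
  apply: (@le_trans _ _ (\sum_(b' : block | sharing b b' == sg) alpha^-1 ^+ c)).
    rewrite [leRHS](bigID (fun b' => windows b :&: windows b' != finset.set0)) /=.
    rewrite -[leLHS]addr0; apply: lerD; last first.
      by apply: sumr_ge0 => *; rewrite exprn_ge0 // invr_ge0 ltW.
    rewrite [leRHS](eq_bigl (fun b' => (windows b :&: windows b' != finset.set0) &&
      (sharing b b' == sg))); last by move=> b'; rewrite andbC.
    apply: ler_sum => b' /andP[_ /eqP e]; rewrite ler_weXn2l //.
      by rewrite invf_ge1.
    by rewrite /c -e card_shared_windows.
  rewrite sumr_const -mulr_natl.
  have cnt : #|[pred b' : block | sharing b b' == sg]|%:R <=
      (#|A| ^ (N ^ d - c))%N%:R :> R.
    rewrite ler_nat /c -b1s; apply: leq_trans (card_same_sharing b b1).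
    by rewrite cardsE.
  apply: le_trans (ler_wpM2r _ cnt) _; first by rewrite exprn_ge0 // invr_ge0 ltW.
  have -> : (#|A| ^ (N ^ d - c))%N%:R * alpha^-1 ^+ c =
      (#|A| ^ (N ^ d))%N%:R * beta^-1 ^+ c :> R.
    rewrite -{2}(subnK cN) expnD natrM -mulrA; congr (_ * _).
    rewrite /beta invfM exprMn mulrCA natrX -exprMn divff ?expr1n ?mulr1 //.
    by rewrite gt_eqF.
  by rewrite ler_wpM2l // ler_wiXn2l // ?invf_le1 // invr_ge0 ltW.
rewrite sumr_const card_ffun card_option card_prod !card_cube /M.
by rewrite -mulrA [leRHS]mulr_natl.
Qed.

End SharedWindows.

(** * The random shift factors onto [Y] *)


(** Pigeonhole on collars; there are few of them since they are thin. *)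
Lemma common_collar {d n N : nat} {A : finType} (G : {set cube_pattern d N A}) :
  (0 < #|A|)%N -> (n <= N)%N ->
  exists W : {set cube_pattern d N A}, [/\ W \subset G,
    forall b b', b \in W -> b' \in W -> same_collar n b b' &
    (#|G| <= #|W| * #|A| ^ (N ^ d - (N - n) ^ d))%N].
Proof.
move=> A0 nN; have [->|[b0 b0G]] := finset.set_0Vmem G.
  by exists finset.set0; split; rewrite ?cards0 // => b b'; rewrite inE.
pose C := [set k : cube d N | [exists i, k i < n]%N]%SET.
have cardC : (#|C| <= N ^ d - (N - n) ^ d)%N.
  have lt (k : cube d (N - n)) i : (k i + n < N)%N.
    by have := ltn_ord (k i); lia.
  pose f (k : cube d (N - n)) : cube d N := [ffun i => Ordinal (lt k i)].
  have f_inj : injective f.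
    move=> k k' /ffunP ff; apply/ffunP => i; apply: val_inj.
    by have := ff i; rewrite !ffunE => /(congr1 val) /= /addIn.
  have : (#|cube d (N - n)| <= #|~: C|)%N.
    rewrite -cardsT -(card_imset _ f_inj); apply: subset_leq_card.
    apply/fintype.subsetP => _ /imsetP[k _ ->]; rewrite !inE negb_exists.
    by apply/forallP => i; rewrite ffunE /= -leqNgt leq_addl.
  by rewrite -(card_cube N) -(card_cube (N - n)) -(cardsC C); lia.
pose g (b : cube_pattern d N A) : {ffun {k | k \in C} -> A} := [ffun k => b (val k)].
pose fib c := [set b in G | g b == c]%SET.
have [c _ cmax] := @arg_maxnP _ (g b0) predT (fun c => #|fib c|) isT.
exists (fib c); split.
- by apply/fintype.subsetP => b; rewrite inE => /andP[].
- move=> b b'; rewrite !inE => /andP[_ /eqP bc] /andP[_ /eqP b'c] k [i ki].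
  have kC : k \in C by rewrite inE; apply/existsP; exists i.
  have : g b = g b' by rewrite bc.
  by move=> /ffunP /(_ (exist _ k kC)); rewrite !ffunE.
apply: (@leq_trans (#|fib c| * #|A| ^ #|C|)); last first.
  by rewrite leq_mul2l leq_pexp2l ?orbT.
have -> : (#|A| ^ #|C| = #|{ffun {k | k \in C} -> A}|)%N.
  by rewrite card_ffun card_sig.
rewrite mulnC -sum_nat_const -sum1_card (partition_big g predT) //=.
apply: leq_sum => c' _; apply: leq_trans (cmax c' isT).
by rewrite sum1_card cardsE.
Qed.

(** The number of spared blocks with distinct windows has mean
    [#|D| * alpha ^ (N ^ d)]. Its relative variance [eps] is tiny, since only
    pairs of blocks with a common window are correlated and these are rare; so
    it is at least half its mean outside an event of probability [4 * eps].
    Then the blocks with the most frequent collar are numerous enough. *)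
Lemma prob_many_blocks {R : realType} {d n N h K M : nat} {A : finType}
    (N_gt0 : (0 < N)%N) (alpha : R) (E : set {set cube_pattern d n A}) :
  (0 < h)%N -> (N <= K * h)%N -> (h.*2.-1 <= n)%N -> (n.*2 <= N)%N ->
  0 <= alpha <= 1 -> 0 < alpha -> 1 <= alpha * #|A|%:R ->
  (2 * ((N ^ d * N ^ d) * #|A| ^ (N ^ d - n)) <= #|A| ^ (N ^ d))%N ->
  M%:R * #|A|%:R ^+ (N ^ d - (N - n) ^ d) <= (alpha * #|A|%:R) ^+ (N ^ d) / 4 ->
  (forall (F : {set cube_pattern d n A}) (W : {set cube_pattern d N A}),
     (forall b, b \in W -> injective (block_window N_gt0 n b)) ->
     (forall b b', b \in W -> b' \in W -> same_collar n b b') ->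
     (forall b p, b \in W -> block_window N_gt0 n b p \notin F) ->
     (M <= #|W|)%N -> E F) ->
  1 - 8 * ((N ^ d * N ^ d).+1 ^ (K ^ d))%N%:R * (alpha * #|A|%:R)^-1 ^+ (n ^ d)
    <= forbid_prob alpha E.
Proof.
move=> h0 NKh hn nN alpha01 a0 beta1 manyD Mbeta EF.
have nN' : (n <= N)%N by lia.
set beta := alpha * _ in beta1 Mbeta *.
have beta0 : 0 < beta by exact: lt_le_trans beta1.
have A0 : (0 < #|A|)%N by rewrite -(ltr0n R); move: beta0; rewrite pmulr_rgt0.
set T := (#|A| ^ (N ^ d))%N.
set D := distinct_blocks N_gt0 n : {set cube_pattern d N A}.
set Q := windows N_gt0 : cube_pattern d N A -> {set cube_pattern d n A}.
set Cnt := (_ ^ (K ^ d))%N.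
have TD : (T <= 2 * #|D|)%N.
  by have := @card_distinct d A N N_gt0 n nN; rewrite -/T -/D; move: manyD; rewrite -/T; lia.
have T0 : (0 < T)%N by rewrite expn_gt0 A0.
have D0 : (0 < #|D|)%N by lia.
have Qm b : b \in D -> #|Q b| = (N ^ d)%N.
  by rewrite inE => /injectiveP w; rewrite card_imset // card_cube.
pose m := (N ^ d)%N.
pose eps : R := 2 * Cnt%:R * beta^-1 ^+ (n ^ d).
have eps0 : 0 <= eps.
  by rewrite /eps !mulr_ge0 // exprn_ge0 // invr_ge0 ltW.
have inner b : b \in D ->
    \sum_(b' in D) alpha ^+ #|Q b :|: Q b'| <= alpha ^+ m ^+ 2 * (#|D|%:R * (1 + eps)).
  move=> bD.
  apply: (@le_trans _ _ (\sum_(b' in D) (alpha ^+ m ^+ 2 +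
    if Q b :&: Q b' != finset.set0 then
      alpha ^+ m ^+ 2 * alpha^-1 ^+ #|Q b :&: Q b'| else 0))).
    apply: ler_sum => b' b'D.
    have cardU : (#|Q b :|: Q b'| + #|Q b :&: Q b'| = m + m)%N.
      by rewrite cardsUI !Qm.
    have [I0|_] := eqVneq (Q b :&: Q b') finset.set0.
      by move: cardU; rewrite I0 cards0 addn0 addr0 => ->; rewrite -exprM muln2 addnn.
    apply: ler_wpDl; first by rewrite !exprn_ge0 // ltW.
    rewrite -exprM muln2 -addnn -cardU exprD -mulrA -exprMn divff ?gt_eqF //.
    by rewrite expr1n mulr1.
  rewrite big_split /= sumr_const -big_mkcondr /= -mulr_sumr.
  set S := \sum_(_ | _) _; have S_le : S <= #|D|%:R * eps.
    have := sum_shared_windows N_gt0 h K h0 NKh hn nN' alpha b.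
    have [a0' a1] := andP alpha01; rewrite a0 a1 => /(_ isT beta1).
    rewrite -/Q -/T -/Cnt -/beta => shared.
    apply: (@le_trans _ _ (Cnt%:R * T%:R * beta^-1 ^+ (n ^ d))).
      apply: le_trans shared.
      rewrite [leRHS](bigID (mem D)) /= /S.
      rewrite (eq_bigl (fun b' => (Q b :&: Q b' != finset.set0) && (b' \in D)));
        last by move=> b'; rewrite andbC.
      by rewrite lerDl sumr_ge0 // => *; rewrite exprn_ge0 // invr_ge0 ltW.
    have TD' : T%:R <= 2 * #|D|%:R :> R by rewrite -natrM ler_nat.
    have cb : 0 <= Cnt%:R * beta^-1 ^+ (n ^ d).
      by rewrite mulr_ge0 // exprn_ge0 // invr_ge0 ltW.
    by have := ler_wpM2l cb TD'; rewrite /eps; lra.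
  rewrite -mulr_natl.
  have a2 : 0 <= alpha ^+ m ^+ 2 by rewrite !exprn_ge0 // ltW.
  by have := ler_wpM2l a2 S_le; lra.
have mom2 : \sum_(b in D) \sum_(b' in D) alpha ^+ #|Q b :|: Q b'| <=
    (#|D|%:R * alpha ^+ m) ^+ 2 * (1 + eps).
  apply: le_trans (ler_sum _ inner) _.
  by rewrite sumr_const -[leLHS]mulr_natl le_eqVlt; apply/orP; left; apply/eqP; ring.
pose Bad (F : {set cube_pattern d n A}) :=
  #|[set b in D | spared (Q b) F]%SET|%:R < #|D|%:R * alpha ^+ m / 2.
have bad : \sum_(F | Bad F) weight (alpha := alpha) F <= 4 * eps :=
  second_moment alpha01 D Q m eps a0 D0 Qm mom2.
have good F : ~~ Bad F -> F \in E.
  rewrite /Bad -leNgt => ZF; rewrite inE.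
  have [W [WG Wcol GW]] := common_collar (n := n) [set b in D | spared (Q b) F]%SET A0 nN'.
  have inW b : b \in W -> b \in D /\ spared (Q b) F.
    by move=> /(fintype.subsetP WG); rewrite inE => /andP[].
  apply: (EF F W) => //.
  - by move=> b /inW[+ _]; rewrite inE => /injectiveP.
  - move=> b p /inW[_]; rewrite /spared => /disjointFr -> //.
    by apply/imsetP; exists p.
  have Apos : 0 < #|A|%:R ^+ (N ^ d - (N - n) ^ d) :> R.
    by rewrite exprn_gt0 // ltr0n.
  rewrite -(ler_nat R) -(ler_pM2r Apos); apply: le_trans Mbeta _.
  rewrite -natrX -natrM; apply: le_trans (_ : #|[set b in D | spared (Q b) F]%SET|%:R <= _).
    apply: le_trans ZF; rewrite /beta exprMn -natrX -/T.
    have TD' : T%:R <= 2 * #|D|%:R :> R by rewrite -natrM ler_nat.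
    have := ler_wpM2l (exprn_ge0 m (ltW a0)) TD'.
    by rewrite /m; lra.
  by rewrite ler_nat.
have -> : forbid_prob alpha E = \sum_(F in E) weight (alpha := alpha) F.
  rewrite /forbid_prob; apply: eq_bigr => F _.
  by rewrite /weight card_cube_pattern.
have w0 := @weight_ge0 R _ alpha alpha01.
apply: (@le_trans _ _ (\sum_(F : {set cube_pattern d n A} | ~~ Bad F) weight (alpha := alpha) F)).
  have := @weight_sum R (cube_pattern d n A : finType) alpha.
  rewrite (bigID Bad) /= => sum1.
  by move: sum1 bad; rewrite /eps; lra.
rewrite [leRHS](bigID (fun F => ~~ Bad F)) /=.
rewrite (eq_bigl (fun F => (F \in E) && ~~ Bad F)); last first.
  by move=> F; case: (boolP (~~ Bad F)) => [/good ->|]; rewrite ?andbF.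
by rewrite lerDl; apply: sumr_ge0.
Qed.

(** * Choice of the scales *)

(** The term of degree [e.+1] of the exponential series is enough. *)
Lemma poly_le_exp {R : realType} (x C : R) (e : nat) : 0 < x -> 0 <= C ->
  \forall n \near \oo, C * n%:R ^+ e <= expR (x * n%:R).
Proof.
move=> x0 C0; near=> n.
have xn : 0 <= x * n%:R by rewrite mulr_ge0 // ltW.
have /(le_trans _) := expR_ge1Dxn e xn; apply.
have f0 : 0 < (e.+1)`!%:R :> R by rewrite ltr0n fact_gt0.
have big : C * (e.+1)`!%:R / x ^+ e.+1 < n%:R by near: n; exact: nbhs_infty_gtr.
move: big; rewrite ltr_pdivrMr ?exprn_gt0 // -ltr_pdivlMr // => /ltW big.
apply: (@le_trans _ _ ((x * n%:R) ^+ e.+1 / (e.+1)`!%:R)); last by rewrite lerDr.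
have := ler_wpM2r (exprn_ge0 e (ler0n R n)) big.
move=> /le_trans; apply; rewrite exprMn [n%:R ^+ e.+1]exprS.
by rewrite le_eqVlt; apply/orP; left; apply/eqP; ring.
Unshelve. all: by end_near.
Qed.

Lemma bernoulli_le {R : realDomainType} (x : R) (d : nat) : 0 <= x <= 1 ->
  1 - d%:R * x <= (1 - x) ^+ d.
Proof.
move=> /andP[x0 x1]; elim: d => [|d IH]; first by rewrite mul0r subr0 expr0.
rewrite exprS; apply: le_trans (ler_wpM2l _ IH); last by rewrite subr_ge0.
have : 0 <= d%:R * x * x by rewrite !mulr_ge0.
by rewrite -natr1; lra.
Qed.

Lemma expr_expR {R : realType} (x : R) k : 0 < x -> x ^+ k = expR (ln x * k%:R).
Proof. by move=> x0; rewrite mulrC expRM_natl lnK ?posrE. Qed.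

(** By Bernoulli's inequality, a collar of width [n] takes a fraction at most
    [d / k] of a block of side at least [k * n]. *)
Lemma collar_small {R : realType} {d n N k : nat} : (0 < n)%N -> (0 < k)%N ->
  (k * n <= N)%N ->
  (N ^ d - (N - n) ^ d)%N%:R <= (N ^ d)%N%:R * (d%:R / k%:R) :> R.
Proof.
move=> n0 k0 knN.
have nN : (n <= N)%N by apply: leq_trans knN; rewrite leq_pmull.
have N0 : 0 < N%:R :> R by rewrite ltr0n; exact: leq_trans n0 nN.
rewrite natrB; last first.
  by case: d => // d; rewrite leq_exp2r // leq_subr.
rewrite !natrX natrB //.
have -> : (N%:R - n%:R) = N%:R * (1 - n%:R / N%:R) :> R.
  by rewrite mulrBr mulr1 mulrCA divff ?mulr1 // gt_eqF.
rewrite exprMn.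
have nN1 : 0 <= (n%:R / N%:R : R) <= 1.
  by rewrite divr_ge0 // ler_pdivrMr // mul1r ler_nat.
have nk : n%:R / N%:R <= k%:R^-1 :> R.
  rewrite ler_pdivrMr // mulrC ler_pdivlMr ?ltr0n //.
  by rewrite -natrM ler_nat mulnC.
have V0 : 0 <= N%:R ^+ d :> R by rewrite exprn_ge0 // ltW.
have := ler_wpM2l V0 (bernoulli_le _ d nN1).
have := ler_wpM2l V0 (ler_wpM2l (ler0n R d) nk).
by lra.
Qed.

(** The side of the blocks is [4 * k] times half a window, rounded up: cells of
    that size tile the torus, and two positions in one cell have windows that
    overlap. *)
Lemma scales_exist n k : (0 < n)%N -> (0 < k)%N ->
  exists h, [/\ (0 < h)%N, (h.*2.-1 <= n)%N, (2 * k * n <= 4 * (k * h))%N,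
    (4 * (k * h) <= 4 * k * n)%N & (n <= 2 * (k * h))%N].
Proof.
by move=> n0 k0; exists (uphalf n); split; try lia; nia.
Qed.

Theorem theorem1p11 (R : realType) (d : nat) (d_ge1 : (1 <= d)%N)
    (AY : finType) (Y : set (config d AY))
    (Y_sft : is_sft Y)
    (Y_fixed : exists y, Y y /\ fixed_point y)
    (Y_fep : finite_extension_property Y)
    (AX : finType) (alpha : R) (alpha01 : 0 <= alpha <= 1)
    (entropy_lt : (entropy R Y < lne (alpha * #|AX|%:R)%:E)%E) :
  exists rho : R, 0 < rho /\
    \forall n \near \oo,
      forbid_prob alpha
        [set F : {set cube_pattern d n AX} | factors_onto (random_sft F) Y]
      >= 1 - expR (- rho * n%:R ^+ d).
Proof.
have Yshift : forall t x, Y x -> Y (shift_by t x) by have [[_ +] _] := Y_sft.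
have [y0 [Yy0 fixy0]] := Y_fixed; have [g fep] := Y_fep.
have [c [q0 factors]] := random_sft_factors d_ge1 Yshift fep Yy0 fixy0.
set beta := alpha * #|AX|%:R in entropy_lt.
have beta0 : 0 < beta.
  rewrite ltNge; apply/negP => b0; move: entropy_lt.
  by rewrite le0_lneNy ?lee_fin // ltNge leNye.
move: entropy_lt; rewrite lne_EFin // => /(entropy_lt_count Yy0 Yshift).
set lam := ln beta => -[lam0 [h' [h'0 h'lam [n0 count]]]].
have beta1 : 1 < beta by rewrite -[beta]lnK ?posrE // expR_gt1.
have [alpha_ge0 alpha_le1] := andP alpha01.
have A_gt0 : 0 < #|AX|%:R :> R.
  by rewrite lt_neqAle ler0n andbT eq_sym; apply: contraTneq beta0 => A0;
    rewrite /beta A0 mulr0 ltxx.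
have alpha0 : 0 < alpha by move: beta0; rewrite pmulr_lgt0.
have A_gt1 : (1 < #|AX|)%N.
  rewrite -(ltr1n R); apply: lt_le_trans beta1 _.
  by rewrite /beta ler_piMl // ltW.
pose LA : R := ln #|AX|%:R.
have LA0 : 0 < LA by rewrite ln_gt0 // ltr1n.
pose eta := lam - h'.
have eta0 : 0 < eta by rewrite subr_gt0.
(* The side is at least [2 * k] times [n], so that the collar costs at most
   a quarter of the gap [eta] between the two entropies. *)
have [k [k0 kLA]] : exists k, (0 < k)%N /\ d%:R * LA / (2 * k)%N%:R <= eta / 4.
  pose r := 4 * d%:R * LA / eta.
  have r0 : 0 <= r by rewrite /r divr_ge0 ?(ltW eta0) // !mulr_ge0 // ltW.
  exists (Num.truncn r).+1; split=> //.
  have rk : r <= (2 * (Num.truncn r).+1)%N%:R.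
    apply: le_trans (ltW (truncnS_gt r)) _.
    by rewrite ler_nat leq_pmull.
  rewrite ler_pdivrMr ?ltr0n // -ler_pdivrMl ?divr_gt0 //.
  by move: rk; rewrite /r; apply: le_trans; rewrite le_eqVlt;
    apply/orP; left; apply/eqP; field; rewrite gt_eqF.
pose K := (4 * k)%N.
exists (lam / 2); split; first by rewrite divr_gt0.
have ln2 : 0 < ln (2 : R) by rewrite ln_gt0 // ltr1n.
have box_ratio : \forall n \near \oo,
    h' * (1 + c.*2%:R * harmonic n) ^+ d <= h' + eta / 4.
  have : h' * (1 + c.*2%:R * harmonic n) ^+ d @[n --> \oo] -->
      h' * (1 + c.*2%:R * 0) ^+ d.
    apply: cvgMl_tmp.
    apply: (@continuous_cvg _ R R _ _ (fun n => 1 + c.*2%:R * harmonic n)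
      (fun x : R => x ^+ d)); first exact: exprn_continuous.
    apply: cvgD; first exact: cvg_cst.
    by apply: cvgMl_tmp; exact: cvg_harmonic.
  rewrite mulr0 addr0 expr1n mulr1 => /cvgr_le; apply.
  by rewrite ltrDl divr_gt0.
near=> n.
have n_gt0 : (0 < n)%N by near: n; exact: nbhs_infty_ge.
have [h [h_gt0 hn1 knN NKn n_2q]] := scales_exist n k n_gt0 k0.
pose q := (k * h)%N; pose N := (4 * q)%N.
have nN : (n <= N)%N.
  by apply: leq_trans n_2q _; rewrite leq_mul2r; apply/orP; right.
have nn_N : (n.*2 <= N)%N.
  by rewrite -mul2n /N -[4%N]/(2 * 2)%N -mulnA leq_mul2l.
have N_gt0 : (0 < N)%N by exact: leq_trans n_gt0 nN.
have Nd : (N <= N ^ d)%N by rewrite -{1}(expn1 N) leq_pexp2l.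
have nd : (n <= n ^ d)%N by rewrite -{1}(expn1 n) leq_pexp2l.
have q0_q : (q0 <= q)%N.
  rewrite -(leq_pmul2l (m := 2)) //; apply: leq_trans n_2q.
  by near: n; exact: nbhs_infty_ge.
pose M := #|` language_fset Y (fun=> N + c.*2)%N|.
pose Cnt := ((N ^ d * N ^ d).+1 ^ (K ^ d))%N.
have NdR : (N ^ d * N ^ d)%N%:R <= (K ^ d * K ^ d)%N%:R * n%:R ^+ (d + d) :> R.
  have NdKn : (N ^ d <= K ^ d * n ^ d)%N.
    by rewrite -expnMn; case: (d) => // d'; rewrite leq_exp2r.
  rewrite -natrX -natrM ler_nat expnD mulnACA.
  exact: leq_mul.
(* Distinct windows are the typical case. *)
have manyD : (2 * ((N ^ d * N ^ d) * #|AX| ^ (N ^ d - n)) <= #|AX| ^ (N ^ d))%N.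
  rewrite -[X in (_ <= _ ^ X)%N](subnK (leq_trans nN Nd)) expnD mulnA.
  rewrite [leqRHS]mulnC.
  rewrite leq_mul2r; apply/orP; right; apply: (@leq_trans (2 ^ n)); last first.
    by rewrite leq_exp2r.
  rewrite -(ler_nat R) [leRHS]natrX (expr_expR 2) //.
  have : (2 * (K ^ d * K ^ d))%N%:R * n%:R ^+ (d + d) <= expR (ln (2 : R) * n%:R).
    by near: n; exact: poly_le_exp.
  apply: le_trans.
  by rewrite natrM [X in _ <= X * _]natrM -mulrA ler_wpM2l.
(* The entropy estimate for [Y] leaves room for the collar. *)
have Mbeta : M%:R * #|AX|%:R ^+ (N ^ d - (N - n) ^ d) <= beta ^+ (N ^ d) / 4.
  have n0N : (n0 <= N + c.*2)%N.
    rewrite (leq_trans _ (leq_addr _ _)) // (leq_trans _ nN) //.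
    by near: n; exact: nbhs_infty_ge.
  have e4 : ln 4 <= eta / 4 * n%:R.
    rewrite -ler_pdivrMl ?divr_gt0 // ltW //.
    by near: n; exact: nbhs_infty_gtr.
  have ratio : h' * (1 + c.*2%:R * harmonic n) ^+ d <= h' + eta / 4.
    by near: n.
  rewrite ler_pdivlMr //.
  pose V : R := (N ^ d)%N%:R.
  have V0 : 0 < V by rewrite ltr0n expn_gt0 N_gt0.
  have nV : n%:R <= V by rewrite ler_nat (leq_trans nN Nd).
  have NR0 : 0 < N%:R :> R by rewrite ltr0n.
  have box_le : (N + c.*2)%N%:R ^+ d <= V * (1 + c.*2%:R * harmonic n) ^+ d :> R.
    rewrite /V natrX -exprMn; apply: lerXn2r; rewrite ?nnegrE //.
      by rewrite !(mulr_ge0, addr_ge0) // harmonic_ge0.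
    rewrite natrD mulrDr mulr1 lerD2l mulrCA ler_peMr // /harmonic.
    rewrite ler_pdivlMr ?ltr0n // mul1r ler_nat.
    by apply: leq_trans nn_N; rewrite -addnn -addn1 leq_add2l.
  have collar_le : (N ^ d - (N - n) ^ d)%N%:R * LA <= V * (eta / 4).
    have k2_gt0 : (0 < 2 * k)%N by rewrite muln_gt0.
    have small := @collar_small R d _ _ _ n_gt0 k2_gt0 knN.
    apply: le_trans (ler_wpM2r (ltW LA0) small) _.
    by rewrite -mulrA ler_pM2l // mulrAC.
  apply: (@le_trans _ _ (expR (h' * (N + c.*2)%N%:R ^+ d) *
      expR (LA * (N ^ d - (N - n) ^ d)%N%:R) * expR (ln 4))).
    rewrite lnK ?posrE // ler_pM2r // -expr_expR // ler_pM2r ?exprn_gt0 //.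
    exact: count.
  rewrite (expr_expR beta) // -!expRD ler_expR -/lam -/V.
  have := ler_wpM2l h'0 box_le; have := ler_wpM2l (ltW V0) ratio.
  have : eta / 4 * n%:R <= eta / 4 * V by rewrite ler_pM2l // divr_gt0.
  have : 0 <= V * eta by rewrite mulr_ge0 // ltW.
  by move: e4 collar_le; rewrite /eta; lra.
have NKh : (N <= K * h)%N by rewrite /N /q /K mulnA.
apply: le_trans (prob_many_blocks N_gt0 alpha _ h_gt0 NKh hn1 nn_N alpha01
  alpha0 (ltW beta1) manyD Mbeta _); last first.
  by move=> F W W1 W2 W3 W4; exact: (factors q n q0_q nN AX F N_gt0 W).
rewrite lerD2l lerN2 -/beta -/Cnt.
have m_eq : beta^-1 ^+ (n ^ d) = expR (- lam * n%:R ^+ d).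
  by rewrite expr_expR ?invr_gt0 // lnV ?posrE // natrX.
have -> : expR (- (lam / 2) * n%:R ^+ d) =
    expR (lam / 2 * n%:R ^+ d) * expR (- lam * n%:R ^+ d).
  by rewrite -expRD; congr expR; field.
rewrite m_eq ler_pM2r ?expR_gt0 //.
apply: (@le_trans _ _ (expR (lam / 2 * n%:R))); last first.
  by rewrite ler_expR ler_pM2l ?divr_gt0 // -natrX ler_nat.
have : (8 * (2 * (K ^ d * K ^ d)) ^ (K ^ d))%N%:R * n%:R ^+ ((d + d) * K ^ d) <=
    expR (lam / 2 * n%:R).
  by near: n; apply: poly_le_exp => //; rewrite divr_gt0.
apply: le_trans; rewrite natrM -mulrA ler_wpM2l // /Cnt !natrX exprM -exprMn.
apply: lerXn2r; rewrite ?nnegrE ?mulr_ge0 ?exprn_ge0 //.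
rewrite [X in _ <= X * _]natrM -mulrA.
apply: (@le_trans _ _ (2 * (N ^ d * N ^ d)%N%:R)); last by rewrite ler_wpM2l.
rewrite -natrM ler_nat.
by rewrite mul2n -addnn -addn1 leq_add2l muln_gt0 !expn_gt0 N_gt0.
Unshelve. all: by end_near.
Qed.
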